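(* Let $T>0$, $d\in\mathbb{N}$, $\alpha\in(0,1)$ and $p\in(1,+\infty)$ with $\alpha>1/p$. Let $K$ be a closed subgroup of $\exp(W_{[1/\alpha]})$, let $X\in W^\alpha_p([0,T];G^{[1/\alpha]}(\mathbb{R}^d)/K)$, and let $F:\mathcal{A}(X)\to\mathbb{R}\cup\{+\infty\}$ be a proper functional, that is, $F(\mathbf{X})\in\mathbb{R}$ for at least one $\mathbf{X}\in\mathcal{A}(X)$. Suppose that $F$ can be extended to a coercive, convex and lower semi-continuous functional $\overline{F}$ defined on the Banach space $W^\alpha_p\big([0,T];\bigoplus_{i=1}^{[1/\alpha]}(\mathbb{R}^d)^{\otimes i}\big)$ such that $\overline{F}=+\infty$ outside $\mathcal{A}(X)$. Then there exists $\mathbf{X}^*\in\mathcal{A}(X)$ with $$F(\mathbf{X}^* )=\min_{\mathbf{X}\in\mathcal{A}(X)}F(\mathbf{X}).$$ If in addition $\overline{F}$ is strictly convex on $\mathcal{A}(X)$, then such a minimizer $\mathbf{X}^*$ is unique.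
   Context: $[r]$ denotes the largest integer $\le r$. For $N\in\mathbb{N}$, $T^N(\mathbb{R}^d)=\bigoplus_{k=0}^N(\mathbb{R}^d)^{\otimes k}$ is the truncated tensor algebra with product $\otimes$ and bracket $[a,b]=a\otimes b-b\otimes a$; $\mathcal{G}^N(\mathbb{R}^d)=W_1\oplus\dots\oplus W_N$ with $W_1=\mathbb{R}^d$, $W_{i+1}=[\mathbb{R}^d,W_i]$, and $G^N(\mathbb{R}^d)=\exp(\mathcal{G}^N(\mathbb{R}^d))$ is the step-$N$ free nilpotent group (product $\otimes$). Every $g\in G^N(\mathbb{R}^d)$ is the step-$N$ signature $S_N(\gamma)_{0,1}$ of some bounded variation path $\gamma:[0,1]\to\mathbb{R}^d$, and the Carnot–Carathéodory norm $\|g\|$ is the infimum of the lengths of such $\gamma$; the metric is $d_{cc}(g,h)=\|g^{-1}\otimes h\|$. For a closed normal subgroup $K$ of $G=G^N(\mathbb{R}^d)$, $\pi_{G,G/K}$ is the canonical homomorphism, and $G/K$ carries the norm $\|gK\|_{G/K}=\inf_{k\in K}\|g\otimes k\|$ and the induced metric $d(x,y)=\|x^{-1}y\|_{G/K}$. For a metric space $(E,d)$, $W^\alpha_p([0,T];E)$ is the set of measurable paths $f:[0,T]\to E$ with $\iint_{[0,T]^2}\frac{d(f(s),f(t))^p}{|t-s|^{\alpha p+1}}\,ds\,dt<\infty$; since $\alpha>1/p$ its elements are taken to be continuous. When $E$ is a finite-dimensional normed vector space, $W^\alpha_p([0,T];E)$ is the usual reflexive fractional Sobolev Banach space (norm: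 $L^p$-norm plus the $p$-th root of the double integral). The admissible set is $$\mathcal{A}(X)=\{\mathbf{X}\in W^\alpha_p([0,T];G^{[1/\alpha]}(\mathbb{R}^d)) : \pi_{G^{[1/\alpha]}(\mathbb{R}^d),G^{[1/\alpha]}(\mathbb{R}^d)/K}(\mathbf{X})=X\}.$$ Viewing $G^{[1/\alpha]}(\mathbb{R}^d)$ as a subset of the affine space $1+\bigoplus_{i=1}^{[1/\alpha]}(\mathbb{R}^d)^{\otimes i}$ and dropping the constant level-$0$ component $1$, $\mathcal{A}(X)$ is regarded as a subset of $W^\alpha_p([0,T];\bigoplus_{i=1}^{[1/\alpha]}(\mathbb{R}^d)^{\otimes i})$. Coercive means that all sublevel sets $\{\overline F\le a\}$, $a\in\mathbb{R}$, are bounded in norm. *)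

(* Defs.v *)
From HB Require Import structures.
From mathcomp Require Import all_boot all_order all_algebra.
From mathcomp Require Import all_classical all_reals all_analysis.

Set Implicit Arguments.
Unset Strict Implicit.
Unset Printing Implicit Defensive.

Import Order.TTheory GRing.Theory Num.Theory.
Import numFieldNormedType.Exports.

Local Open Scope classical_set_scope.
Local Open Scope ring_scope.

(** ** The truncated tensor algebra *)

(* A tensor is given by its coordinates in the basis
   e_(i1) ⊗ ... ⊗ e_(ik), 0 <= k <= N, of T^N(R^d); this basis is indexed by
   the words of length at most N over 'I_d. *)
Notation word N d := (N.-bseq 'I_d).
Notation tensor R N d := {ffun word N d -> R^o}.

Section TensorAlgebra.
Context {R : realType} {N d : nat}.
Local Notation TN := (tensor R N d).

Definition tone : TN := [ffun w : word N d => (nilp w)%:R].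

(* e_u ⊗ e_v = e_(u ++ v), which is 0 when u ++ v is longer than N. *)
Definition tprod (a b : TN) : TN :=
  [ffun w : word N d => \sum_(u : word N d)
     \sum_(v : word N d | u ++ v == w :> seq 'I_d) a u * b v].

Definition tpow (a : TN) (k : nat) : TN := iter k (tprod a) tone.

(* For a with level-0 component 1, tone - a is nilpotent of order N + 1, so the
   Neumann series stops and this is the inverse of a. *)
Definition tinv (a : TN) : TN := \sum_(k < N.+1) tpow (tone - a) k.

(* Only applied to tensors with level-0 component 0, whose (N + 1)-st power
   vanishes. *)
Definition texp (a : TN) : TN := \sum_(k < N.+1) (k`!%:R)^-1 *: tpow a k.

Definition tbracket (a b : TN) : TN := tprod a b - tprod b a.

Definition lin_span (A : set TN) : set TN :=
  [set v | exists n (c : 'I_n -> R) (a : 'I_n -> TN),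
     (forall i, A (a i)) /\ v = \sum_(i < n) c i *: a i].

Definition level1 : set TN :=
  [set a | forall w : word N d, size w != 1 -> a w = 0].

(* lie_layer i is W_i for i >= 1. *)
Fixpoint lie_layer (i : nat) : set TN :=
  match i with
  | 0 => [set 0]
  | 1 => level1
  | j.+1 => lin_span [set tbracket x y | x in level1 & y in lie_layer j]
  end.

Definition free_lie : set TN :=
  [set a | exists2 y : nat -> TN,
     forall i, lie_layer i (y i) & a = \sum_(1 <= i < N.+1) y i].

Definition free_group : set TN := texp @` free_lie.

End TensorAlgebra.

Definition enorm {R : realType} {I : finType} (v : I -> R) : R :=
  Num.sqrt (\sum_i v i ^+ 2).

(** ** Signatures and the Carnot-Caratheodory metric *)

Section Signature.
Context {R : realType} {N d : nat}.
Local Notation TN := (tensor R N d).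
Implicit Types gamma : R -> 'rV[R]_d.

(* l is the Riemann-Stieltjes integral of f against dg over [a, b]; the points
   of the partition are a :: s, and xi i is the tag of the i-th subinterval. *)
Definition is_RS_integral (f g : R -> R) (a b l : R) : Prop :=
  forall e : R, 0 < e -> exists2 delta : R, 0 < delta &
    forall (s : seq R) (xi : nat -> R), itv_partition a b s ->
      (forall i, (i < size s)%N ->
         [/\ nth b (a :: s) i <= xi i, xi i <= nth b (a :: s) i.+1
           & nth b (a :: s) i.+1 - nth b (a :: s) i < delta]) ->
      `| \sum_(0 <= i < size s)
           f (xi i) * (g (nth b (a :: s) i.+1) - g (nth b (a :: s) i)) - l |
      < e.

(* S t is the step-N signature of gamma over [0, t] for t in [0, 1]: its
   coordinate at the word i1 ... ik is the iterated integral of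
   dgamma^i1_(t1) ... dgamma^ik_(tk) over 0 < t1 < ... < tk < t. *)
Definition is_signature_path gamma (S : R -> TN) : Prop :=
  forall t : R, 0 <= t <= 1 ->
    S t [bseq] = 1 /\
    forall (u w : word N d) (i : 'I_d), w = rcons u i :> seq 'I_d ->
      is_RS_integral (fun r => S r u) (fun r => gamma r ord0 i) 0 t (S t w).

Definition has_signature gamma (g : TN) : Prop :=
  exists2 S : R -> TN, is_signature_path gamma S & S 1 = g.

Definition path_length gamma : \bar R :=
  ereal_sup [set (\sum_(0 <= i < size s)
      enorm (fun j : 'I_d => gamma (nth 1 (0 :: s) i.+1) ord0 j
                           - gamma (nth 1 (0 :: s) i) ord0 j))%:E
    | s in itv_partition 0 1].

(* The signature is defined through Riemann-Stieltjes integrals, so paths of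
   bounded variation are continuous, as usual in rough path theory. *)
Definition bv_path gamma : Prop :=
  {within `[0, 1], continuous gamma} /\ (path_length gamma < +oo)%E.

Definition cc_norm (g : TN) : \bar R :=
  ereal_inf [set path_length gamma
    | gamma in [set gamma | bv_path gamma /\ has_signature gamma g]].

Definition cc_dist (g h : TN) : \bar R := cc_norm (tprod (tinv g) h).

(** ** Quotients of the free nilpotent group *)

(* K is a subgroup of (H, ⊗), closed in H for the metric cc_dist. *)
Definition closed_subgroup (H K : set TN) : Prop :=
  [/\ K `<=` H, K tone,
      forall g h, K g -> K h -> K (tprod g h),
      forall g, K g -> K (tinv g)
    & forall g, H g ->
        (forall e : R, 0 < e -> exists2 k, K k & (cc_dist g k < e%:E)%E) ->
        K g].

Definition lcoset (K : set TN) (g : TN) : set TN := [set tprod g k | k in K].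

Definition coset_space (K : set TN) : set (set TN) := lcoset K @` free_group.

(* On the coset gK this is the infimum of cc_norm (g ⊗ k) over k in K. *)
Definition quotient_norm (x : set TN) : \bar R :=
  ereal_inf [set cc_norm h | h in x].

(* For cosets x and y of a normal subgroup, the coset x^-1 y is the set of all
   products a^-1 ⊗ b with a in x and b in y. *)
Definition quotient_dist (x y : set TN) : \bar R :=
  quotient_norm [set tprod (tinv a) b | a in x & b in y].

End Signature.

(** ** Fractional Sobolev spaces *)

(* Paths on [0, T] are functions on the subtype of points of [0, T]. *)
Notation time T := (set_type (`[0, T]%classic)).

Section Sobolev.
Context {R : realType}.
Variables (T alpha p : R).
Local Notation mu := (@lebesgue_measure R).

(* 'valL_ 0 extends a function on [0, T] by 0. *)
Definition time_integral (h : time T -> \bar R) : \bar R :=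
  (\int[mu]_(t in `[0%R, T]) 'valL_ 0 h t)%E.

Definition time_integral2 (h : time T -> time T -> \bar R) : \bar R :=
  (\int[mu \x mu]_(z in `[0%R, T] `*` `[0%R, T])
     'valL_ 0 (fun s => 'valL_ 0 (h s) z.2) z.1)%E.

Definition sobolev_energy (E : Type) (dist : E -> E -> \bar R)
    (f : time T -> E) : \bar R :=
  time_integral2 (fun s t =>
    poweR (dist (f s) (f t)) p
      * ((`|val t - val s| `^ (alpha * p + 1))^-1)%:E)%E.

(* The continuous paths of finite energy in the metric space with underlying
   set A and distance dist. *)
Definition sobolev_path (E : Type) (A : set E) (dist : E -> E -> \bar R)
    (f : time T -> E) : Prop :=
  [/\ forall t, A (f t),
      forall s (e : R), 0 < e -> exists2 delta : R, 0 < delta &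
        forall t, `|val t - val s| < delta -> (dist (f s) (f t) < e%:E)%E
    & (sobolev_energy dist f < +oo)%E].

Definition euclid_dist (I : finType) (x y : {ffun I -> R^o}) : \bar R :=
  (enorm (x - y))%:E.

(* The Banach space W^alpha_p([0, T]; R^I). *)
Definition sobolev_space (I : finType) : set (time T -> {ffun I -> R^o}) :=
  sobolev_path setT (@euclid_dist I).

Definition sobolev_norm (I : finType) (f : time T -> {ffun I -> R^o}) : R :=
  fine (poweR (time_integral (fun t => (enorm (f t) `^ p)%:E)) p^-1
        + poweR (sobolev_energy (@euclid_dist I) f) p^-1)%E.

End Sobolev.

Arguments sobolev_space {R T} alpha p I _.
Arguments sobolev_norm {R T} alpha p I f.

(** ** The admissible set *)

Section Admissible.
Context {R : realType} {N d : nat}.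
Variables (T alpha p : R).

Definition admissible (K : set (tensor R N d))
    (X : time T -> set (tensor R N d)) : set (time T -> tensor R N d) :=
  [set Y | sobolev_path alpha p free_group cc_dist Y
           /\ forall t, lcoset K (Y t) = X t].

End Admissible.

Notation pos_word N d := {w : word N d | (0 < size w)%N}.
(* The direct sum of the levels 1, ..., N of T^N(R^d). *)
Notation pos_tensor R N d := {ffun pos_word N d -> R^o}.

Definition drop_level0 {R : realType} {N d : nat} (a : tensor R N d) :
    pos_tensor R N d := [ffun w : pos_word N d => a (val w)].

(** ** Functionals with values in the extended reals *)

Section Functionals.
Context {R : realType} {E : lmodType R}.
Implicit Types (W : set E) (nrm : E -> R) (Phi : E -> \bar R).

Definition coercive_on W nrm Phi : Prop :=
  forall a : R, exists M : R,
    forall f, W f -> (Phi f <= a%:E)%E -> nrm f <= M.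

Definition convex_on W Phi : Prop :=
  forall (f g : E) (l : R), W f -> W g -> 0 < l < 1 ->
    (Phi (l *: f + (1 - l) *: g)%R <= l%:E * Phi f + (1 - l)%:E * Phi g)%E.

(* Strictness is only meaningful where Phi is finite: the right-hand side is
   +oo otherwise. *)
Definition strictly_convex_on W Phi : Prop :=
  forall (f g : E) (l : R), W f -> W g ->
    (Phi f < +oo)%E -> (Phi g < +oo)%E -> f <> g -> 0 < l < 1 ->
    (Phi (l *: f + (1 - l) *: g)%R < l%:E * Phi f + (1 - l)%:E * Phi g)%E.

Definition lower_semicontinuous_on W nrm Phi : Prop :=
  forall (f : E) (a : R), W f -> (a%:E < Phi f)%E ->
    exists2 delta : R, 0 < delta &
      forall g, W g -> nrm (g - f) < delta -> (a%:E < Phi g)%E.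

End Functionals.

Definition is_minimizer {R : realType} {E : Type} (A : set E) (F : E -> \bar R)
    (x : E) : Prop :=
  A x /\ forall y, A y -> (F x <= F y)%E.

(* Main.v *)
Require Import Defs.
From HB Require Import structures.
From mathcomp Require Import all_boot all_order all_algebra.
From mathcomp Require Import all_classical all_reals all_analysis.
From mathcomp Require Import measurable_realfun ring lra.

(** The functional Fbar is minimized over the whole Sobolev space by the direct
method; since Fbar is +oo off the admissible set, a minimizer with a finite
value is admissible.  Two facts carry the argument.

Reflexivity enters only through uniform convexity.  Write Psi f for the sum
over the coordinates f_i of f of
  int |f_i|^p + iint |f_i(s) - f_i(t)|^p / |t - s|^(alpha p + 1),
which is equivalent to the p-th power of the Sobolev norm.  The scalar
inequality [powR_uniform_convexity] passes to integrals, so Psi is uniformly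
convex in a modular sense.  In a space that is complete for such a Psi, every
decreasing sequence of nonempty convex closed bounded sets C_n has a common
point ([nested_convex_nonempty]): nearly minimal elements of Psi on the C_n form
a Cauchy sequence, because their midpoints stay in C_n.  Applied to sublevel sets
of a coercive, convex, lower semi-continuous functional this gives a minimizer
([convex_minimizer]).  Completeness of the space of continuous paths is where
alpha > 1/p is used: the Morrey estimate [morrey_bound] bounds the supremum by
Psi, so a Cauchy sequence converges uniformly, and Fatou's lemma identifies its
limit in the sense of Psi ([sobolev_complete]).

To compare F on the admissible set with Fbar on the Sobolev space, admissible
paths must belong to that space ([group_path_sobolev]).  A signature of a path
of length L has coordinates of size at most L^k at level k
([signature_bound]), so h - g = g (g^-1 h - 1) is bounded by a multiple of the
Carnot-Caratheodory distance of g and h as long as g stays bounded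
([tensor_sub_cc]); a continuous path on [0, T] is bounded.

Uniqueness follows by evaluating Fbar at the midpoint of two minimizers; two
admissible paths with the same levels 1, ..., N are equal because their level-0
components are 1. *)

Set Implicit Arguments.
Unset Strict Implicit.
Unset Printing Implicit Defensive.
Import Order.TTheory GRing.Theory Num.Theory.
Import numFieldNormedType.Exports.
Local Open Scope classical_set_scope.
Local Open Scope ring_scope.

(** * The truncated tensor algebra *)

Section TensorProduct.
Context {R : realType} {N d : nat}.
Local Notation TN := (tensor R N d).
Implicit Types a b c g : TN.

Lemma tprodE a b (w : word N d) : tprod a b w =
  \sum_(u : word N d) \sum_(v : word N d)
    (u ++ v == w :> seq 'I_d)%:R * (a u * b v).
Proof.
rewrite ffunE; apply: eq_bigr => u _; rewrite big_mkcond /=.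
by apply: eq_bigr => v _; case: eqP => _; rewrite ?mul1r ?mul0r.
Qed.

(** The sum over u picks the word s when s is short enough to be a word.  A
prefix of a word is short enough, so no term is lost to the truncation; this is
what makes the truncated product associative. *)
Lemma sum_word_catl (s : seq 'I_d) (v w : word N d) :
  \sum_(u : word N d) (s == u)%:R * (u ++ v == w :> seq 'I_d)%:R
  = (s ++ v == w)%:R :> R.
Proof.
have [sN|sN] := leqP (size s) N.
  rewrite (bigD1 (Bseq sN)) //= eqxx mul1r big1 ?addr0// => u.
  by rewrite -val_eqE /= eq_sym => /negPf ->; rewrite mul0r.
rewrite big1 => [|u _].
  case: eqP => // /(congr1 size); rewrite size_cat => e.
  by have := size_bseq w; rewrite -e leqNgt (leq_trans sN)// leq_addr.
case: eqP => [e|]; last by rewrite mul0r.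
by move: sN; rewrite e ltnNge size_bseq.
Qed.

Lemma sum_word_catr (s : seq 'I_d) (v w : word N d) :
  \sum_(u : word N d) (s == u)%:R * (v ++ u == w :> seq 'I_d)%:R
  = (v ++ s == w)%:R :> R.
Proof.
have [sN|sN] := leqP (size s) N.
  rewrite (bigD1 (Bseq sN)) //= eqxx mul1r big1 ?addr0// => u.
  by rewrite -val_eqE /= eq_sym => /negPf ->; rewrite mul0r.
rewrite big1 => [|u _].
  case: eqP => // /(congr1 size); rewrite size_cat => e.
  by have := size_bseq w; rewrite -e leqNgt (leq_trans sN)// leq_addl.
case: eqP => [e|]; last by rewrite mul0r.
by move: sN; rewrite e ltnNge size_bseq.
Qed.

(** Both sides are sums over the factorizations of w into three words. *)
Lemma tprodA a b c : tprod a (tprod b c) = tprod (tprod a b) c.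
Proof.
apply/ffunP => w; rewrite !tprodE.
transitivity (\sum_(x : word N d) \sum_(y : word N d) \sum_(z : word N d)
    (x ++ y ++ z == w :> seq 'I_d)%:R * (a x * b y * c z)).
  apply: eq_bigr => x _.
  under eq_bigr => v _.
    rewrite tprodE !mulr_sumr.
    under eq_bigr do rewrite !mulr_sumr.
    over.
  rewrite exchange_big; apply: eq_bigr => y _ /=.
  rewrite exchange_big; apply: eq_bigr => z _ /=.
  rewrite -sum_word_catr mulr_suml; apply: eq_bigr => u _; ring.
rewrite exchange_big/=; under eq_bigr do rewrite exchange_big /=.
rewrite exchange_big/=.
under [RHS]eq_bigr => u _.
  under eq_bigr => z _.
    rewrite tprodE mulr_suml mulr_sumr.
    under eq_bigr do rewrite mulr_suml mulr_sumr.
    over.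
  over.
rewrite [RHS]exchange_big; apply: eq_bigr => z _ /=.
rewrite [RHS]exchange_big [LHS]exchange_big; apply: eq_bigr => x _ /=.
rewrite [RHS]exchange_big; apply: eq_bigr => y _ /=.
rewrite catA -sum_word_catl mulr_suml; apply: eq_bigr => u _; ring.
Qed.

Lemma tprod1x a : tprod tone a = a.
Proof.
apply/ffunP => w; rewrite tprodE (bigD1 [bseq])//= [X in _ + X]big1 => [|u].
  rewrite addr0 (bigD1 w)//= eqxx ffunE !mul1r big1 ?addr0// => v.
  by rewrite -val_eqE /= => /negPf ->; rewrite mul0r.
rewrite -val_eqE /= => u0; apply: big1 => v _.
by rewrite ffunE /nilp size_eq0 (negPf u0) mul0r mulr0.
Qed.

Lemma tprodx1 a : tprod a tone = a.
Proof.
apply/ffunP => w; rewrite tprodE exchange_big (bigD1 [bseq])//=.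
rewrite [X in _ + X]big1 => [|u].
  rewrite addr0 (bigD1 w)//= cats0 eqxx ffunE mulr1 mul1r big1 ?addr0// => v.
  by rewrite -val_eqE /= cats0 => /negPf ->; rewrite mul0r.
rewrite -val_eqE /= => u0; apply: big1 => v _.
by rewrite ffunE /nilp size_eq0 (negPf u0) !mulr0.
Qed.

Lemma tprodBl a b c : tprod (a - b) c = tprod a c - tprod b c.
Proof.
apply/ffunP => w; rewrite !ffunE -sumrB; apply: eq_bigr => u _.
by rewrite -sumrB; apply: eq_bigr => v _; rewrite !ffunE mulrBl.
Qed.

Lemma tprodBr a b c : tprod a (b - c) = tprod a b - tprod a c.
Proof.
apply/ffunP => w; rewrite !ffunE -sumrB; apply: eq_bigr => u _.
by rewrite -sumrB; apply: eq_bigr => v _; rewrite !ffunE mulrBr.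
Qed.

Lemma tprod0r a : tprod a 0 = 0.
Proof. by have := tprodBr a 0 0; rewrite !subrr. Qed.

Lemma tprodDr a b c : tprod a (b + c) = tprod a b + tprod a c.
Proof. by rewrite -{1}(opprK c) -(sub0r c) !tprodBr tprod0r sub0r opprK. Qed.

Lemma tprod_sumr a (I : finType) (F : I -> TN) :
  tprod a (\sum_i F i) = \sum_i tprod a (F i).
Proof. exact: (big_morph _ (tprodDr a) (tprod0r a)). Qed.

Lemma tprod_nil a b : tprod a b [bseq] = a [bseq] * b [bseq].
Proof.
rewrite tprodE (bigD1 [bseq])//= [X in _ + X]big1 => [|u].
  rewrite addr0 (bigD1 [bseq])//= !mul1r big1 ?addr0// => v.
  by rewrite -val_eqE /= => /negPf ->; rewrite mul0r.
rewrite -val_eqE /= => u0; apply: big1 => v _.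
by case: (val u) u0 => //= *; rewrite mul0r.
Qed.

(** Each factor of a nonzero term consumes at least one letter of w. *)
Lemma tpow_eq0 a k (w : word N d) :
  a [bseq] = 0 -> (size w < k)%N -> tpow a k w = 0.
Proof.
move=> a0; elim: k w => [//|k IH] w; rewrite ltnS => wk /=.
rewrite ffunE big1// => u _; apply: big1 => v /eqP uv.
have [u0|u0] := eqVneq u [bseq]; first by rewrite u0 a0 mul0r.
rewrite IH ?mulr0//; apply: leq_trans wk; rewrite -uv size_cat.
rewrite -{1}(add0n (size v)) ltn_add2r lt0n size_eq0.
by apply: contra u0 => /eqP u0; apply/eqP/val_inj.
Qed.

(** The Neumann series of x = tone - g telescopes, and its remainder x^(N+1)
vanishes. *)
Lemma tprod_tinv g : g [bseq] = 1 -> tprod g (tinv g) = tone.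
Proof.
move=> g1; set x := tone - g.
have x0 : x [bseq] = 0 by rewrite !ffunE /= g1 subrr.
have gE : g = tone - x by rewrite /x opprB addrC subrK.
rewrite /tinv -/x tprod_sumr {1}gE; clearbody x.
under eq_bigr do rewrite tprodBl tprod1x.
rewrite -(big_mkord xpredT (fun k => tpow x k - tprod x (tpow x k))) /=.
rewrite -[LHS]opprK -sumrN.
under eq_bigr do rewrite opprB.
rewrite (telescope_sumr (tpow x) (leq0n _)) opprB.
suff -> : tpow x N.+1 = 0 by rewrite subr0.
by apply/ffunP => w; rewrite tpow_eq0 ?ffunE// ltnS size_bseq.
Qed.

Lemma tensorBE a b (w : word N d) : (a - b) w = a w - b w.
Proof. by rewrite !ffunE. Qed.

Lemma lie_layer_nil i a : lie_layer i a -> a [bseq] = 0.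
Proof.
case: i => [->|[|i]] /=; first by rewrite ffunE.
  by move=> /(_ [bseq]) -> .
move=> [n [c [f [H ->]]]]; rewrite sum_ffunE; apply: big1 => j _.
have [x _ [y _ <-]] := H j.
by rewrite ffunE tensorBE !tprod_nil mulrC subrr scaler0.
Qed.

Lemma free_group_nil g : free_group g -> g [bseq] = 1.
Proof.
move=> [a [y Hy ay] <-].
have a0 : a [bseq] = 0.
  by rewrite ay sum_ffunE; apply: big1 => i _; exact: lie_layer_nil.
rewrite /texp sum_ffunE (bigD1 ord0)//= big1 => [|i i0].
  by rewrite ffunE [X in _ *: X]ffunE /= invr1 scale1r addr0.
rewrite ffunE tpow_eq0 ?scaler0//=.
by rewrite lt0n.
Qed.

Lemma tprod_bound a b (A B : R) (w : word N d) :
  (forall u, `|a u| <= A) -> (forall v, `|b v| <= B) ->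
  `|tprod a b w| <= (#|{: word N d}| ^ 2)%:R * (A * B).
Proof.
move=> aA bB; rewrite tprodE.
have -> : (#|{: word N d}| ^ 2)%:R * (A * B)
    = \sum_(u : word N d) \sum_(v : word N d) (A * B).
  by rewrite !sumr_const -mulrnA mulnn -[RHS]mulr_natl.
apply: (le_trans (ler_norm_sum _ _ _)); apply: ler_sum => u _.
apply: (le_trans (ler_norm_sum _ _ _)); apply: ler_sum => v _.
rewrite !normrM; case: eqP => _; rewrite ?normr1 ?normr0 ?mul0r ?mul1r.
  by apply: ler_pM.
by apply: mulr_ge0; [exact: le_trans (aA u)|exact: le_trans (bB v)].
Qed.

(** This is h - g = g (g^-1 h - 1): a group increment close to the unit makes
the two elements close as tensors, with a constant that depends on the size of
g. *)
Lemma tensor_sub_bound g h (A B : R) (w : word N d) : g [bseq] = 1 ->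
  (forall u, `|g u| <= A) ->
  (forall v, `|tprod (tinv g) h v - tone v| <= B) ->
  `|h w - g w| <= (#|{: word N d}| ^ 2)%:R * (A * B).
Proof.
move=> g1 gA HB.
have -> : h w - g w = tprod g (tprod (tinv g) h - tone) w.
  by rewrite tprodBr tprodA tprod_tinv// tprod1x tprodx1 tensorBE.
by apply: tprod_bound => // v; rewrite tensorBE.
Qed.

End TensorProduct.

(** * Signatures and the Carnot-Caratheodory distance *)

Section SignatureBound.
Context {R : realType} {N d : nat}.
Local Notation TN := (tensor R N d).
Implicit Types gamma : R -> 'rV[R]_d.

Lemma ex_fine_partition (t delta : R) : 0 <= t -> 0 < delta ->
  exists2 s, itv_partition 0 t s & forall i, (i < size s)%N ->
    nth t (0 :: s) i.+1 - nth t (0 :: s) i < delta.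
Proof.
move=> t0 dl0.
(* [path] with this relation is stable under appending a point, unlike the
   indexed form of the claim *)
suff [s es /eqP ls] : exists2 s, path (fun x y => x < y < x + delta) 0 s
    & last 0 s == t.
  exists s.
    by split; [apply: sub_path es => x y /andP[]|apply/eqP].
  move=> i si; move/(pathP t) : es => /(_ i si) /andP[_].
  by rewrite -ltrBlDl.
have h0 : 0 < delta / 2 by apply: divr_gt0.
have [n tn] : exists n : nat, t <= n%:R * (delta / 2).
  exists (Num.bound (t / (delta / 2))); rewrite -ler_pdivrMr//.
  by rewrite ltW// archi_boundP// divr_ge0// ltW.
elim: n t t0 tn => [|n IH] t t0 tn.
  by exists [::] => //=; rewrite eq_sym eq_le t0 andbT (le_trans tn)// mul0r.
have [tle|tgt] := leP t (delta / 2).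
  have [->|tn0] := eqVneq t 0; first by exists [::] => /=.
  exists [:: t] => //=; rewrite andbT add0r lt0r tn0 t0 (le_lt_trans tle)//.
  lra.
have [||s es /eqP ls] := IH (t - delta / 2).
- by rewrite subr_ge0 ltW.
- by rewrite -natr1 mulrDl mul1r in tn; rewrite lerBlDr.
exists (rcons s t); last by rewrite last_rcons.
by rewrite rcons_path es ls /=; apply/andP; split; lra.
Qed.

Lemma ge_coord_enorm (I : finType) (v : I -> R) i : `|v i| <= enorm v.
Proof.
rewrite /enorm -sqrtr_sqr ler_sqrt; last exact: sumr_ge0 (fun _ _ => sqr_ge0 _).
rewrite (bigD1 i)//= lerDl; apply: sumr_ge0 => *; exact: sqr_ge0.
Qed.

Lemma enorm_ge0 (I : finType) (v : I -> R) : 0 <= enorm v.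
Proof. exact: sqrtr_ge0. Qed.

(** A partition of [0, t] with t < 1 becomes one of [0, 1] by appending 1. *)
Lemma partial_length_le gamma (L t : R) s : (path_length gamma <= L%:E)%E ->
  t <= 1 -> itv_partition 0 t s ->
  \sum_(0 <= i < size s)
     enorm (fun j : 'I_d => gamma (nth t (0 :: s) i.+1) ord0 j
                          - gamma (nth t (0 :: s) i) ord0 j) <= L.
Proof.
move=> gL t1 st.
have full (u : seq R) : itv_partition 0 1 u ->
  \sum_(0 <= i < size u)
     enorm (fun j : 'I_d => gamma (nth 1 (0 :: u) i.+1) ord0 j
                          - gamma (nth 1 (0 :: u) i) ord0 j) <= L.
  move=> u1; rewrite -lee_fin; apply: le_trans gL.
  by apply: ereal_sup_ubound; exists u.
have [t1' |] := ltP t 1; last first.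
  move=> t1'; have tE : t = 1 by apply/le_anti; rewrite t1 t1'.
  by rewrite tE in st *; exact: full.
have := full (s ++ [:: 1]) (itv_partition_cat st (itv_partition1 t1')).
rewrite size_cat addn1 big_nat_recr//=.
apply: le_trans.
rewrite -[X in X <= _]addr0; apply: lerD; last exact: enorm_ge0.
rewrite le_eqVlt; apply/orP; left; apply/eqP.
apply: eq_big_nat => i /andP[_ si].
rewrite nth_cat si -cat_cons nth_cat /= ltnS (ltnW si).
rewrite (set_nth_default 1)//; congr enorm; apply/funext => j.
by rewrite (set_nth_default 1) //= ltnS ltnW.
Qed.

(** A Riemann-Stieltjes sum is at most the bound of the integrand times the sum
of the increments of the integrator, and the latter is a partial length. *)
Lemma RS_integral_bound gamma (i : 'I_d) (f : R -> R) (t l B L : R) :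
  (path_length gamma <= L%:E)%E -> 0 <= t <= 1 -> 0 <= B ->
  (forall r, 0 <= r <= t -> `|f r| <= B) ->
  is_RS_integral f (fun r => gamma r ord0 i) 0 t l -> `|l| <= B * L.
Proof.
move=> gL /andP[t0 t1] B0 fB RS; apply/ler_addgt0Pr => e e0.
have [dl dl0 H] := RS e e0.
have [s st sdl] := ex_fine_partition t0 dl0.
have := H s (fun i => nth t (0 :: s) i) st.
set S := (X in `|X - l| < e) => /(_ _)/ltW Sl.
have {}Sl : `|S - l| <= e.
  apply: Sl => k sk; split => //; last exact: sdl.
  by move/(pathP t): (st.1) => /(_ k sk) /ltW.
have -> : l = S - (S - l) by rewrite opprB addrC subrK.
apply: (le_trans (ler_normB _ _)); apply: lerD => //.
apply: le_trans (ler_wpM2l B0 (partial_length_le gL t1 st)).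
rewrite mulr_sumr; apply: (le_trans (ler_norm_sum _ _ _)).
rewrite !big_seq; apply: ler_sum => k; rewrite mem_index_iota /= => sk.
rewrite normrM; apply: ler_pM => //; last first.
  exact: (@ge_coord_enorm _ (fun j : 'I_d => _ ord0 j - _ ord0 j) i).
apply: fB; rewrite (itv_partition_nth_ge _ st) ?(itv_partition_nth_le _ st)//.
all: by rewrite ltnS ltnW.
Qed.

(** Induction on the length of the word: each letter adds one integration, hence
one factor L. *)
Lemma signature_bound gamma (S : R -> TN) (L : R) :
  (path_length gamma <= L%:E)%E -> 0 <= L -> is_signature_path gamma S ->
  forall w t, 0 <= t <= 1 -> `|S t w| <= L ^+ size w.
Proof.
move=> gL L0 sg w.
have [n] := ubnP (size w); elim: n w => // n IH w wn t t01.
have [s wE] : {s | val w = s} by exists (val w).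
case/lastP: s wE => [|u i] wE.
  have -> : w = [bseq] by exact: val_inj.
  by rewrite (sg t t01).1 normr1 expr0.
have uN : (size u <= N)%N.
  by apply: leq_trans (size_bseq w); rewrite wE size_rcons.
have := (sg t t01).2 (Bseq uN) w i wE.
have -> : size w = (size u).+1 by rewrite wE size_rcons.
rewrite exprSr; apply: RS_integral_bound => //; first exact: exprn_ge0.
move=> r /andP[r0 rt]; apply: (IH (Bseq uN)).
  by move: wn; rewrite ltnS wE size_rcons.
by rewrite r0 (le_trans rt)//; case/andP: t01.
Qed.

Lemma path_length_ge0 gamma : (0 <= path_length gamma)%E.
Proof.
apply: (@le_trans _ _ (\sum_(0 <= i < size [:: (1 : R)])
     enorm (fun j : 'I_d => gamma (nth 1 (0 :: [:: (1:R)]) i.+1) ord0 j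
                          - gamma (nth 1 (0 :: [:: (1:R)]) i) ord0 j))%:E).
  by rewrite lee_fin; apply: sumr_ge0 => *; exact: enorm_ge0.
by apply: ereal_sup_ubound; exists [:: 1] => //; exact: itv_partition1.
Qed.

Lemma cc_norm_ge0 (g : TN) : (0 <= cc_norm g)%E.
Proof. by apply: le_ereal_inf_tmp => _ [gm _ <-]; exact: path_length_ge0. Qed.

(** For L <= 1 every power L^k with k >= 1 is at most L. *)
Lemma cc_norm_bound (g : TN) (L : R) : (cc_norm g < L%:E)%E -> L <= 1 ->
  forall w, `|g w - tone w| <= L.
Proof.
move=> /ereal_inf_lt[_ [gm [_ [S SS S1]] <-] /ltW gL] L1 w.
have L0 : 0 <= L.
  by rewrite -lee_fin; exact: le_trans (path_length_ge0 _) gL.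
have o01 : 0 <= (1:R) <= 1 by rewrite ler01 lexx.
have [w0|w0] := eqVneq w [bseq].
  by rewrite w0 -S1 (SS 1 o01).1 ffunE subrr normr0.
have wp : (0 < size w)%N.
  by rewrite lt0n size_eq0; apply: contra w0 => /eqP w0; apply/eqP/val_inj.
have -> : tone w = 0 :> R by rewrite ffunE /nilp -leqn0 leqNgt wp.
rewrite subr0 -S1; apply: (le_trans (signature_bound gL L0 SS w o01)).
rewrite -{2}(expr1 L); exact: ler_wiXn2l.
Qed.

(** On bounded sets and at distance less than 1, the coordinates are Lipschitz
for the Carnot-Caratheodory distance.  The infimum that defines the distance
need not be attained, hence the passage to the limit in the proof. *)
Lemma tensor_sub_cc (g h : TN) (A : R) : g [bseq] = 1 ->
  (forall u, `|g u| <= A) -> (cc_dist g h < 1)%E ->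
  forall w, `|h w - g w| <= (#|{: word N d}| ^ 2)%:R * (A * fine (cc_dist g h)).
Proof.
move=> g1 gA gh1 w.
have A0 : 0 <= A by exact: le_trans (gA [bseq]).
have ghf : cc_dist g h \is a fin_num.
  by rewrite ge0_fin_numE ?cc_norm_ge0// (lt_trans gh1)// ltry.
move: gh1; rewrite -(fineK ghf) lte_fin; set c := fine _ => c1.
set n := _%:R.
have n0 : 0 <= n by rewrite ler0n.
apply/ler_addgt0Pr => e e0.
have nA : 0 < n * A + 1 by rewrite ltr_wpDl// mulr_ge0.
have dl0 : 0 < Num.min (1 - c) (e / (n * A + 1)).
  by rewrite lt_min subr_gt0 c1 divr_gt0.
set dl := Num.min _ _ in dl0.
apply: (@le_trans _ _ (n * (A * (c + dl)))).
  apply: tensor_sub_bound => // v; apply: cc_norm_bound.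
    by rewrite -[X in (X < _)%E](fineK ghf) lte_fin ltrDl.
  by rewrite -lerBrDl ge_min lexx.
rewrite mulrDr mulrDr lerD2l mulrA.
apply: (@le_trans _ _ ((n * A + 1) * dl)).
  by apply: ler_wpM2r; [exact: ltW|rewrite lerDl].
by rewrite mulrC -ler_pdivlMr// ge_min lexx orbT.
Qed.

End SignatureBound.

(** * Uniform convexity of the p-th power *)

Section PointwiseConvexity.
Context {R : realType}.
Variable p : R.
Hypothesis p1 : 1 < p.

Let p0 : 0 < p. Proof. exact: lt_trans ltr01 p1. Qed.
Let pn0 : p != 0. Proof. by rewrite gt_eqF. Qed.

Lemma le_powR2l (x y : R) : 0 <= x -> x <= y -> x `^ p <= y `^ p.
Proof.
move=> x0 xy; apply: ge0_ler_powR => //; first exact: ltW.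
by rewrite nnegrE (le_trans x0).
Qed.

Lemma continuous_norm_powR : continuous (fun x : R => `|x| `^ p).
Proof.
move=> a; have [->|a0] := eqVneq a 0.
  apply/cvgrPdist_lt => e e0; near=> x.
  rewrite normr0 powR0// sub0r normrN ger0_norm ?powR_ge0//.
  have -> : e = (e `^ p^-1) `^ p by rewrite -powRrM mulVf// powRr1// ltW.
  apply: gt0_ltr_powR => //; rewrite ?nnegrE ?powR_ge0//.
  near: x; have d0 : 0 < e `^ p^-1 by rewrite powR_gt0.
  exists (e `^ p^-1) => //= x /=; by rewrite sub0r normrN.
apply: (@continuous_comp _ _ _ (fun x : R => `|x|) (fun y => y `^ p)).
  exact: norm_continuous.
apply: differentiable_continuous; apply/derivable1_diffP/derivable_powR.
by rewrite in_itv/= andbT normr_gt0.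
Unshelve. all: by end_near. Qed.

(** For u > 0, with u = exp (l / p) and u^p = exp l, the claim is the weighted arithmetic and
geometric mean inequality for exp l and 1, which follows from the tangent
inequality 1 + x < exp x at x = l (1 - 1/p) and x = - l / p. *)
Lemma bernoulli_strict (u : R) : 0 <= u -> u != 1 -> 1 + p * (u - 1) < u `^ p.
Proof.
rewrite le0r => /orP[/eqP -> _|u0 u1].
  rewrite powR0//; move: p1; lra.
set l := p * ln u.
have l0 : l != 0 by rewrite mulf_neq0// ln_eq0.
have uE : u = expR (l / p) by rewrite /l mulrAC divff// mul1r lnK// posrE.
have q0 : 0 < 1 - p^-1 by rewrite subr_gt0 invf_lt1.
have H1 : 1 + l * (1 - p^-1) < expR (l * (1 - p^-1)).
  by apply: expR_gt1Dx; rewrite mulf_neq0// gt_eqF.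
have H2 : 1 + - (l / p) < expR (- (l / p)).
  by apply: expR_gt1Dx; rewrite oppr_eq0 mulf_neq0// invr_neq0.
have -> : u `^ p = u * expR (l * (1 - p^-1)).
  rewrite /powR (gt_eqF u0) -/l [in RHS]uE -expRD; congr expR; by field.
have E1 : u * expR (- (l / p)) = 1.
  by rewrite {1}uE -expRD subrr expR0.
have : u * (1 - l / p) < 1 by rewrite -[ltRHS]E1 ltr_pM2l.
have : u * (1 + l * (1 - p^-1)) < u * expR (l * (1 - p^-1)) by rewrite ltr_pM2l.
set X := u * expR _.
set c := p^-1 in q0 *; have pc : p * c = 1 by rewrite mulfV.
move=> h1 h2.
have : (p - 1) * (u * (1 - l * c)) < (p - 1) * 1.
  by rewrite ltr_pM2l// subr_gt0.
have -> : (p - 1) * (u * (1 - l * c)) = p * u - u - u * l * (p * c) + u * l * c.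
  ring.
rewrite pc; nra.
Qed.

(** Strict convexity: the tangent of x^p at the midpoint m lies strictly below at
a and at b, and its two values there have mean m^p. *)
Lemma powR_midpoint_lt (a b : R) : 0 <= a -> 0 <= b -> a != b ->
  ((a + b) / 2) `^ p < (a `^ p + b `^ p) / 2.
Proof.
move=> a0 b0 ab; set m := (a + b) / 2.
have m0 : 0 < m.
  rewrite divr_gt0// lt_neqAle addr_ge0// andbT eq_sym paddr_eq0//.
  by apply/negP => /andP[/eqP aE /eqP bE]; rewrite aE bE eqxx in ab.
have mE : m + m = a + b by rewrite /m; field.
have H x : 0 <= x -> x != m -> m `^ p * (1 + p * (x / m - 1)) < x `^ p.
  move=> x0 xm.
  have -> : x `^ p = m `^ p * (x / m) `^ p.
    rewrite -powRM; [|exact: ltW|by rewrite divr_ge0// ltW].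
    by rewrite mulrC divfK// gt_eqF.
  rewrite ltr_pM2l ?powR_gt0//; apply: bernoulli_strict.
    by rewrite divr_ge0// ltW.
  by apply: contra xm => /eqP xm; rewrite -[x](divfK (lt0r_neq0 m0)) xm mul1r.
have am : a != m.
  apply: contra ab => /eqP e; apply/eqP; lra.
have bm : b != m.
  apply: contra ab => /eqP e; apply/eqP; lra.
have := ltrD (H a a0 am) (H b b0 bm).
rewrite -mulrDr.
have -> : 1 + p * (a / m - 1) + (1 + p * (b / m - 1)) = 2.
  have -> : b = m + m - a by lra.
  by field; rewrite gt_eqF.
by rewrite ltr_pdivlMr.
Qed.

(** The convexity defect of the pair (1, t). *)
Let gap (t : R) := (1 + `|t| `^ p) / 2 - `|(1 + t) / 2| `^ p.

Let gap_gt0 t : -1 <= t <= 1 -> t != 1 -> 0 < gap t.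
Proof.
move=> /andP[t1 t2] tn1; rewrite /gap subr_gt0.
have [->|tm1] := eqVneq t (-1).
  by rewrite subrr mul0r normr0 powR0// divr_gt0// ltr_pwDl// powR_ge0.
have nt1 : 1 != `|t|.
  by rewrite eq_sym eqr_norml negb_and negb_or tn1 tm1.
have := powR_midpoint_lt ler01 (normr_ge0 t) nt1; rewrite powR1.
apply: le_lt_trans.
apply: le_powR2l => //.
rewrite normrM (ger0_norm (_ : 0 <= 2^-1)) ?invr_ge0//.
rewrite ler_pM2r ?invr_gt0//.
by apply: (le_trans (ler_normD _ _)); rewrite normr1.
Qed.

Let continuous_gap : continuous gap.
Proof.
have H : continuous (fun t : R => (1 + t) / 2).
  move=> x; apply: cvgM; last exact: cvg_cst.
  by apply: cvgD; [exact: cvg_cst|exact: cvg_id].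
have K : continuous (fun t : R => `|(1 + t) / 2| `^ p).
  move=> t; apply: (@continuous_comp R R R (fun t => (1 + t) / 2)
    (fun x => `|x| `^ p) t (H t)).
  exact: continuous_norm_powR.
move=> t; apply: cvgB; last exact: K.
apply: cvgM; last exact: cvg_cst.
by apply: cvgD; [exact: cvg_cst|exact: continuous_norm_powR].
Qed.

(** Two numbers that are far apart relative to their size have a definite
convexity defect.  By homogeneity the larger one may be taken to be 1, and then
the defect is continuous and positive on a compact interval that stays away from
1.  Stating the defect without subtraction lets the inequality be integrated in
the extended reals. *)
Lemma powR_uniform_convexity (e : R) : 0 < e -> exists2 C : R, 0 <= C &
  forall a b : R, `|a - b| `^ p + C * `|(a + b) / 2| `^ p
    <= (e + C / 2) * (`|a| `^ p + `|b| `^ p).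
Proof.
move=> e0; set eta := Num.min 1 (e `^ p^-1).
have eta0 : 0 < eta by rewrite lt_min ltr01 powR_gt0.
have eta1 : eta <= 1 by rewrite ge_min lexx.
have etap : eta `^ p <= e.
  have -> : e = (e `^ p^-1) `^ p by rewrite -powRrM mulVf// powRr1// ltW.
  by apply: le_powR2l; [exact: ltW|rewrite ge_min lexx orbT].
have [||c cI cmin] := @EVT_min R gap (-1) (1 - eta).
- lra.
- exact: continuous_subspaceT continuous_gap.
have c0 : 0 < gap c.
  move: cI; rewrite in_itv/= => /andP[c1 c2]; apply: gap_gt0.
    by rewrite c1 (le_trans c2)// gerBl ltW.
  by rewrite lt_eqF// (le_lt_trans c2)// gtrBl.
(* |1 - t|^p <= 2^p is absorbed by C times the defect when t <= 1 - eta *)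
set C := 2 `^ p / gap c.
have C0 : 0 <= C by rewrite divr_ge0 ?powR_ge0// ltW.
exists C => //.
have core t : -1 <= t <= 1 ->
    `|1 - t| `^ p + C * `|(1 + t) / 2| `^ p <= (e + C / 2) * (1 + `|t| `^ p).
  move=> /andP[t1 t2].
  have -> : (e + C / 2) * (1 + `|t| `^ p)
      = e * (1 + `|t| `^ p) + C * ((1 + `|t| `^ p) / 2) by lra.
  rewrite -lerBrDr -addrA -mulrBr -/(gap t).
  have et : 0 <= e * (1 + `|t| `^ p).
    by rewrite mulr_ge0 ?ltW// ltr_pwDl// powR_ge0.
  have [tle|tgt] := leP t (1 - eta).
    apply: ler_wpDl => //; apply: (@le_trans _ _ (2 `^ p)).
      by apply: le_powR2l => //; rewrite ger0_norm; lra.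
    have -> : 2 `^ p = C * gap c by rewrite /C divfK// gt_eqF.
    by apply: ler_wpM2l => //; apply: cmin; rewrite in_itv/= t1.
  apply: ler_wpDr.
    apply: mulr_ge0 => //; have [->|tn1] := eqVneq t 1.
      rewrite /gap normr1 powR1 (_ : (1 + 1) / 2 = 1) ?normr1 ?powR1; lra.
    by apply/ltW/gap_gt0; rewrite ?t1.
  apply: (@le_trans _ _ e).
    by apply: le_trans etap; apply: le_powR2l => //; rewrite ger0_norm; lra.
  by apply: ler_peMr; [exact: ltW|rewrite lerDl powR_ge0].
have le_case a b : `|b| <= `|a| ->
   `|a - b| `^ p + C * `|(a + b) / 2| `^ p
    <= (e + C / 2) * (`|a| `^ p + `|b| `^ p).
  move=> ba; have [a0|a0] := eqVneq a 0.
    move: ba; rewrite a0 normr0 normr_le0 => /eqP ->.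
    by rewrite subrr addr0 mul0r normr0 powR0// !(mulr0, addr0).
  have bE : b = a * (b / a) by rewrite mulrC divfK.
  set t := b / a in bE.
  have t1 : -1 <= t <= 1.
    by rewrite -ler_norml /t normrM normfV ler_pdivrMr ?normr_gt0// mul1r.
  have := ler_wpM2l (powR_ge0 `|a| p) (core t t1).
  rewrite mulrDr mulrCA -powRM// -normrM mulrBr mulr1.
  rewrite -powRM// -normrM [X in _ + C * `|X| `^ _ <= _]mulrA mulrDr mulr1 -bE.
  by move=> /le_trans; apply; rewrite mulrCA mulrDr mulr1 -powRM// -normrM -bE.
move=> a b; have [|/ltW ab] := leP `|b| `|a|; first exact: le_case.
rewrite distrC (addrC a b) (addrC (`|a| `^ p)); exact: le_case.
Qed.

Lemma powR_norm_add (a b : R) :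
  `|a + b| `^ p <= 2 `^ p * (`|a| `^ p + `|b| `^ p).
Proof.
wlog ab : a b / `|b| <= `|a|.
  move=> H; have [|/ltW ab] := leP `|b| `|a|; first exact: H.
  by rewrite addrC (addrC (`|a| `^ p)); exact: H.
apply: (@le_trans _ _ (2 `^ p * `|a| `^ p)); last first.
  by rewrite ler_wpM2l ?powR_ge0// lerDl powR_ge0.
rewrite -powRM//; apply: le_powR2l => //.
by apply: (le_trans (ler_normD _ _)); rewrite mulr_natl mulr2n lerD2l.
Qed.

End PointwiseConvexity.

(** * Integrals of p-th powers *)

Section Monotone.
Local Open Scope ereal_scope.
Context d (X : measurableType d) {R : realType}.
Variables (mu : {measure set X -> \bar R}) (D : set X).

(** The integral of a nonnegative function is a supremum over the simple functions
below it, so monotonicity holds without measurability.  The energy of a path in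
the group needs this: its integrand is not known to be measurable. *)
Lemma ge0_le_integral_nomeas (f g : X -> \bar R) :
  (forall z, D z -> 0 <= f z) -> (forall z, D z -> f z <= g z) ->
  \int[mu]_(z in D) f z <= \int[mu]_(z in D) g z.
Proof.
move=> f0 fg.
have g0 z : D z -> 0 <= g z by move=> Dz; exact: le_trans (f0 z Dz) (fg z Dz).
rewrite !ge0_integralE//; apply: ereal_sup_le => _ [h hf <-].
exists h => // z; apply: (le_trans (hf z)).
by rewrite /patch; case: ifPn => // /set_mem; exact: fg.
Qed.

End Monotone.

Section Modular.
Context d (X : measurableType d) {R : realType}.
Variables (mu : {measure set X -> \bar R}) (D : set X) (w : X -> R) (p : R).
Hypothesis mD : measurable D.
Hypothesis w0 : forall z, 0 <= w z.
Hypothesis mw : measurable_fun D w.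
Hypothesis p1 : 1 < p.

(** The p-th power of a weighted L^p norm.  Both halves of the p-th power of the
Sobolev norm have this form, one on [0, T] and one on its square. *)
Definition modular (h : X -> R) : \bar R :=
  (\int[mu]_(z in D) (w z * `|h z| `^ p)%:E)%E.

Implicit Types g h : X -> R.

Lemma modular_ge0 h : (0 <= modular h)%E.
Proof.
by apply: integral_ge0 => z _; rewrite lee_fin mulr_ge0// powR_ge0.
Qed.

Lemma measurable_modular_integrand h : measurable_fun D h ->
  measurable_fun D (fun z => (w z * `|h z| `^ p : R)%:E).
Proof.
move=> mh; apply/measurable_EFinP; apply: measurable_funM => //.
apply: (@measurableT_comp _ _ _ _ _ _ (fun x : R => x `^ p)).
  exact: measurable_powR.
exact: measurableT_comp.
Qed.

Lemma le_modular g h : (forall z, D z -> `|g z| <= `|h z|) ->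
  (modular g <= modular h)%E.
Proof.
move=> gh; apply: ge0_le_integral_nomeas => z Dz; rewrite lee_fin.
  by rewrite mulr_ge0// powR_ge0.
apply: ler_wpM2l => //; apply: le_powR2l => //; exact: gh.
Qed.

Lemma eq_modular g h : (forall z, D z -> g z = h z) -> modular g = modular h.
Proof. by move=> gh; apply: eq_integral => z /set_mem /gh ->. Qed.

Lemma modular_scale (c : R) h : measurable_fun D h ->
  modular (fun z => c * h z) = ((`|c| `^ p)%:E * modular h)%E.
Proof.
move=> mh; rewrite /modular -ge0_integralZl_EFin ?powR_ge0//; last 2 first.
- by move=> z _; rewrite lee_fin mulr_ge0// powR_ge0.
- exact: measurable_modular_integrand.
by apply: eq_integral => z _; rewrite -EFinM normrM powRM// mulrCA.
Qed.

Lemma modular_linear (a b : R) g h : 0 <= a -> 0 <= b ->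
  measurable_fun D g -> measurable_fun D h ->
  (a%:E * modular g + b%:E * modular h)%E =
  (\int[mu]_(z in D) (w z * (a * `|g z| `^ p + b * `|h z| `^ p))%:E)%E.
Proof.
move=> a0 b0 mg mh.
have mI := measurable_modular_integrand.
have I0 f z : D z -> (0 <= (w z * `|f z| `^ p)%:E)%E.
  by rewrite lee_fin mulr_ge0// powR_ge0.
rewrite /modular -ge0_integralZl_EFin//; [|exact: I0|exact: mI].
rewrite -ge0_integralZl_EFin//; [|exact: I0|exact: mI].
rewrite -ge0_integralD//.
- by apply: eq_integral => z _; rewrite -!EFinM -EFinD mulrDr !(mulrCA (w z)).
- by move=> z Dz; rewrite mule_ge0// I0.
- by apply: measurable_funeM; exact: mI.
- by move=> z Dz; rewrite mule_ge0// I0.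
- by apply: measurable_funeM; exact: mI.
Qed.

Lemma modular_triangle g h : measurable_fun D g -> measurable_fun D h ->
  (modular (fun z => g z + h z)%R
   <= (2 `^ p)%:E * modular g + (2 `^ p)%:E * modular h)%E.
Proof.
move=> mg mh; rewrite modular_linear ?powR_ge0//.
apply: ge0_le_integral_nomeas => z Dz; rewrite lee_fin.
  by rewrite mulr_ge0// powR_ge0.
by apply: ler_wpM2l => //; rewrite -mulrDr; exact: powR_norm_add.
Qed.

Lemma modular_uniform_convexity (e C : R) g h : 0 <= e -> 0 <= C ->
  (forall a b : R, `|a - b| `^ p + C * `|(a + b) / 2| `^ p
    <= (e + C / 2) * (`|a| `^ p + `|b| `^ p)) ->
  measurable_fun D g -> measurable_fun D h ->
  (modular (fun z => g z - h z)%R + C%:E * modular (fun z => (g z + h z) / 2)%R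
   <= (e + C / 2)%:E * modular g + (e + C / 2)%:E * modular h)%E.
Proof.
move=> e0 C0 H mg mh; rewrite modular_linear ?addr_ge0 ?divr_ge0//.
rewrite -[X in (X + _ <= _)%E]mul1e.
rewrite (modular_linear ler01 C0); last 2 first.
- exact: measurable_funB.
- apply: measurable_funM; last exact: measurable_cst.
  exact: measurable_funD.
apply: ge0_le_integral_nomeas => z Dz; rewrite lee_fin.
  by rewrite mulr_ge0// addr_ge0// mulr_ge0// powR_ge0.
by apply: ler_wpM2l => //; rewrite mul1r -mulrDr; exact: H.
Qed.

Lemma modular_fatou (h_ : nat -> X -> R) h (c : \bar R) :
  (forall n, measurable_fun D (h_ n)) ->
  (forall z, D z -> (h_ n z @[n --> \oo] --> h z)) ->
  (exists n0, forall n, (n0 <= n)%N -> modular (h_ n) <= c)%E ->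
  (modular h <= c)%E.
Proof.
move=> mh hc [n0 H].
have mI := measurable_modular_integrand.
have -> : modular h = (\int[mu]_(z in D)
    limn_einf (fun n => (w z * `|h_ n z| `^ p)%:E))%E.
  apply: eq_integral => z /set_mem Dz.
  have K : ((w z * `|h_ n z| `^ p)%:E @[n --> \oo] --> (w z * `|h z| `^ p)%:E)%E.
    apply: cvg_EFin; first exact: nearW.
    apply: cvgM; first exact: cvg_cst.
    exact: (cvg_comp _ _ (hc z Dz) (@continuous_norm_powR _ _ p1 _)).
  by rewrite (cvg_limn_einf_sup K).1.
apply: (le_trans (fatou mu mD (fun n => mI _ (mh n)) _)).
  by move=> n z Dz; rewrite lee_fin mulr_ge0// powR_ge0.
rewrite limn_einf_lim; apply: lime_le; first exact: is_cvg_einfs.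
near=> n; apply: le_trans (H (maxn n n0) (leq_maxr _ _)).
by apply: ereal_inf_lbound; exists (maxn n n0) => //=; exact: leq_maxl.
Unshelve. all: by end_near. Qed.

End Modular.

(** * The Morrey estimate *)

Section SetFubini.
Local Open Scope ereal_scope.
Context d1 d2 (T1 : measurableType d1) (T2 : measurableType d2) {R : realType}.
Variables (m1 : {sigma_finite_measure set T1 -> \bar R})
  (m2 : {sigma_finite_measure set T2 -> \bar R}).

Lemma ge0_integral_setX (A : set T1) (B : set T2) (f : T1 * T2 -> \bar R) :
  measurable A -> measurable B -> measurable_fun setT f ->
  (forall z, 0 <= f z) ->
  \int[m1 \x m2]_(z in A `*` B) f z =
  \int[m1]_(x in A) \int[m2]_(y in B) f (x, y).
Proof.
move=> mA mB mf f0; rewrite integral_mkcond fubini_tonelli1.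
- rewrite [RHS]integral_mkcond; apply: eq_integral => x _.
  rewrite /fubini_F patchE; case: ifPn => [/set_mem Ax|xA].
    rewrite [RHS]integral_mkcond; apply: eq_integral => y _.
    rewrite !patchE; congr (if _ then _ else _).
    by apply/idP/idP => [/set_mem[_ By]|/set_mem By]; apply/mem_set.
  apply: integral0_eq => y _; rewrite patchE; case: ifPn => // /set_mem[/= Ax _].
  by move: xA; rewrite notin_setE.
- apply/(measurable_restrictT _ _).1; first exact: measurableX.
  exact: measurable_funTS.
- by move=> z; apply: erestrict_ge0 => *.
Qed.

End SetFubini.

Section Morrey.
Context {R : realType}.
Variables (T alpha p : R).
Hypotheses (T0 : 0 < T) (p1 : 1 < p) (alphap : p^-1 < alpha).
Local Notation mu := (@lebesgue_measure R).

Definition sobolev_weight (z : R * R) : R :=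
  (`|z.2 - z.1| `^ (alpha * p + 1))^-1.

Definition increment (g : R -> R) (z : R * R) : R := g z.1 - g z.2.

Definition square : set (R * R) := `[0, T] `*` `[0, T].

Let p0 : 0 < p. Proof. exact: lt_trans ltr01 p1. Qed.
Let beta := alpha - p^-1.
Let beta0 : 0 < beta. Proof. by rewrite subr_gt0. Qed.
Let betap : beta * p = alpha * p - 1.
Proof. by rewrite /beta mulrBl mulVf// gt_eqF. Qed.

Lemma sobolev_weight_ge0 z : 0 <= sobolev_weight z.
Proof. by rewrite invr_ge0 powR_ge0. Qed.

Lemma measurable_sobolev_weight D : measurable_fun D sobolev_weight.
Proof.
apply: measurable_funTS.
rewrite (_ : sobolev_weight =
  fun z => `|z.2 - z.1| `^ (- (alpha * p + 1))); last first.
  by apply/funext => z; rewrite powRN.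
apply: (@measurableT_comp _ _ _ _ _ _ (fun x : R => x `^ (- (alpha * p + 1)))).
  exact: measurable_powR.
apply: measurableT_comp => //; apply: measurable_funB => //.
Qed.

Lemma measurable_increment D g : measurable_fun setT g ->
  measurable_fun D (increment g).
Proof.
move=> mg; apply: measurable_funTS; apply: measurable_funB.
  exact: measurableT_comp.
exact: measurableT_comp.
Qed.

Lemma measurable_square : measurable square.
Proof. exact: measurableX. Qed.

Lemma lebesgue_itvcc (a h : R) : 0 <= h -> mu `[a, a + h]%classic = h%:E.
Proof.
move=> h0; rewrite lebesgue_measure_itv/= lte_fin ltrDl.
rewrite -EFinD addrAC subrr add0r lt_neqAle h0 andbT eq_sym.
by case: eqP => [->|].
Qed.

(* With B = h^beta, either |u| <= B or |u| <= |u|^p B^(1 - p); in the second case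
   the powers of h cancel because beta p = alpha p - 1. *)
Let increment_pointwise (h s t u : R) : 0 < h -> `|t - s| <= h ->
  (s = t -> u = 0) ->
  `|u| <= h `^ beta +
     h `^ beta * h ^+ 2 * ((`|t - s| `^ (alpha * p + 1))^-1 * `|u| `^ p).
Proof.
move=> h0 ts u0; set B := h `^ beta.
have B0 : 0 < B by exact: powR_gt0.
have X0 : 0 <= B * h ^+ 2 * ((`|t - s| `^ (alpha * p + 1))^-1 * `|u| `^ p).
  by rewrite !mulr_ge0 ?invr_ge0 ?powR_ge0 ?exprn_ge0// ltW.
have [uB|Bu] := leP `|u| B; first by rewrite ler_wpDr.
apply: ler_wpDl; first exact: ltW.
have st : s != t.
  by apply/eqP => /u0 e; move: Bu; rewrite e normr0 ltNge ltW.
have ap0 : 0 <= alpha * p + 1.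
  have : 0 < alpha * p - 1 by rewrite -betap mulr_gt0.
  lra.
have U0 : 0 < `|u| by exact: lt_trans Bu.
have -> : `|u| `^ p = `|u| * `|u| `^ (p - 1) by rewrite mulr_powRB1.
rewrite [X in _ * X]mulrCA [X in _ <= X]mulrCA -[X in X <= _]mulr1.
rewrite ler_pM2l//.
have W : (h `^ (alpha * p + 1))^-1 <= (`|t - s| `^ (alpha * p + 1))^-1.
  rewrite lef_pV2 ?posrE ?powR_gt0//; last first.
    by rewrite normr_gt0 subr_eq0 eq_sym.
  by apply: ge0_ler_powR; rewrite ?nnegrE// ltW.
have V : B `^ (p - 1) <= `|u| `^ (p - 1).
  apply: ge0_ler_powR; rewrite ?nnegrE ?subr_ge0//; apply: ltW => //.
apply: (@le_trans _ _ (B * h ^+ 2 * ((h `^ (alpha * p + 1))^-1 * B `^ (p - 1)))).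
  have -> : B * h ^+ 2 * ((h `^ (alpha * p + 1))^-1 * B `^ (p - 1)) =
    h ^+ 2 * (h `^ (alpha * p + 1))^-1 * (B * B `^ (p - 1)) by ring.
  rewrite mulr_powRB1//; last exact: ltW.
  rewrite /B -powRrM betap -powR_mulrn; last exact: ltW.
  have hn0 (x y : R) : (x + y == 0) ==> (h != 0) by rewrite (gt_eqF h0) implybT.
  rewrite -powRN -!powRD//.
  have -> : 2 - (alpha * p + 1) + (alpha * p - 1) = 0 by ring.
  by rewrite powRr0.
apply: ler_wpM2l; first by rewrite mulr_ge0 ?exprn_ge0// ltW.
by apply: ler_pM => //; rewrite ?invr_ge0 powR_ge0.
Qed.

Variable g : R -> R.
Hypothesis cg : continuous g.
Hypothesis gL : (modular mu `[0%R, T]%classic (fun=> 1%R) p g <= 1)%E.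
Hypothesis gE :
  (modular (mu \x mu) square sobolev_weight p (increment g) <= 1)%E.

Let mg : measurable_fun setT g. Proof. exact: continuous_measurable_fun. Qed.

(* On a square of side h the mean of the increments is of order h^beta. *)
Let double_integral_bound (a h : R) : 0 < h ->
  `[a, a + h]%classic `<=` `[0, T]%classic ->
  (\int[mu \x mu]_(z in `[a, (a + h)%R] `*` `[a, (a + h)%R]) `|increment g z|%:E
   <= (2 * (h `^ beta * h ^+ 2))%:E)%E.
Proof.
move=> h0 sub; set I2 := _ `*` _.
have mI2 : measurable I2 by exact: measurableX.
have sub2 : I2 `<=` square by move=> z [/= z1 z2]; split; exact: sub.
set K := h `^ beta * h ^+ 2.
have K0 : 0 <= K by rewrite mulr_ge0 ?powR_ge0// exprn_ge0// ltW.
pose F (z : R * R) : \bar R := (sobolev_weight z * `|increment g z| `^ p)%:E.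
have mF D : measurable D -> measurable_fun D F.
  move=> mD; apply: measurable_modular_integrand => //.
    exact: measurable_sobolev_weight.
  exact: measurable_increment.
have F0 z : (0 <= F z)%E.
  by rewrite lee_fin mulr_ge0// ?powR_ge0// sobolev_weight_ge0.
apply: (@le_trans _ _
  (\int[mu \x mu]_(z in I2) (cst (h `^ beta)%:E z + K%:E * F z))%E).
  apply: ge0_le_integral_nomeas => // -[s t] [/= sI tI].
  rewrite /F -EFinM -EFinD lee_fin; apply: increment_pointwise => //.
    move: sI tI; rewrite /= !in_itv/= => /andP[s1 s2] /andP[t1 t2].
    by rewrite ler_norml; apply/andP; split; lra.
  by move=> /= ->; rewrite /increment subrr.
rewrite ge0_integralD//; last 3 first.
- by move=> z _; rewrite lee_fin powR_ge0.
- by move=> z _; rewrite mule_ge0.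
- by apply: measurable_funeM; exact: mF.
have muI2 : ((mu \x mu) I2 = (h * h)%:E)%E.
  by rewrite [LHS]product_measure1E//= lebesgue_itvcc// ltW.
rewrite integral_cst// [X in (_ * X + _)%E]muI2.
rewrite mulr_natl mulr2n EFinD; apply: leeD.
  by rewrite -!EFinM lee_fin /K expr2.
rewrite ge0_integralZl_EFin//; last exact: mF.
rewrite -[leRHS]mule1; apply: lee_wpmul2l; first by rewrite lee_fin.
apply: le_trans gE; apply: ge0_subset_integral => //.
- exact: measurable_square.
- exact: mF measurable_square.
Qed.

(* Pigeonhole: some s in the interval has mean increment at most twice the
   mean over the square. *)
Let ex_center (a h : R) : 0 < h -> `[a, a + h]%classic `<=` `[0, T]%classic ->
  exists2 s, s \in `[a, a + h] &
    (\int[mu]_(t in `[a, (a + h)%R]) `|g s - g t|%:E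
     <= (4 * (h `^ beta * h))%:E)%E.
Proof.
move=> h0 sub; apply: contrapT => nex.
have H s : `[a, a + h]%classic s -> ((4 * (h `^ beta * h))%:E <=
     \int[mu]_(t in `[a, (a + h)%R]) `|g s - g t|%:E)%E.
  by move=> Is; rewrite leNgt; apply/negP => /ltW lt; apply: nex; exists s.
have := double_integral_bound h0 sub.
rewrite ge0_integral_setX//; last first.
  apply/measurable_EFinP; apply: measurableT_comp => //.
  exact: measurable_increment.
apply/negP; rewrite -ltNge.
apply: (@lt_le_trans _ _
  (\int[mu]_(x in `[a, (a + h)%R]) cst (4 * (h `^ beta * h))%:E x)%E).
  rewrite integral_cst//= lebesgue_itvcc ?ltW// -EFinM lte_fin.
  have : 0 < h `^ beta * h * h by rewrite !mulr_gt0// powR_gt0.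
  rewrite expr2; lra.
apply: ge0_le_integral_nomeas => // z zI.
by rewrite lee_fin !mulr_ge0 ?powR_ge0// ltW.
Qed.

Let dist_le_integral (a h u v c1 c2 : R) : 0 < h ->
  (\int[mu]_(t in `[a, (a + h)%R]) `|u - g t|%:E <= c1%:E)%E ->
  (\int[mu]_(t in `[a, (a + h)%R]) `|v - g t|%:E <= c2%:E)%E ->
  `|u - v| * h <= c1 + c2.
Proof.
move=> h0 H1 H2; rewrite -lee_fin EFinD; apply: le_trans (leeD H1 H2).
have m x : measurable_fun `[a, a + h]%classic (fun t => `|x - g t|%:E).
  apply: measurable_funTS; apply/measurable_EFinP; apply: measurableT_comp => //.
  exact: measurable_funB.
rewrite -ge0_integralD//; [|exact: m|exact: m].
rewrite EFinM -(lebesgue_itvcc a (ltW h0)) -integral_cst//.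
apply: ge0_le_integral_nomeas => t _; first by rewrite lee_fin.
rewrite /= -EFinD lee_fin.
have -> : u - v = (u - g t) - (v - g t) by ring.
exact: ler_normB.
Qed.

(** The first two terms bound the value at scale 0, the last one is the sum of the
changes over all scales. *)
Definition morrey_const : R :=
  4 * T `^ beta + (T + 1) / T + 12 * T `^ beta / (1 - 2^-1 `^ beta).

(** Intervals shrinking homothetically to x have centers s n whose values change
by at most a multiple of 2^(- beta n) from one scale to the next.  The sum of a
geometric series bounds all g (s n), hence g x by continuity, and the largest
scale is controlled by the L^p part.  Working with values g (s n) instead of
means keeps all the integrals nonnegative. *)
Lemma morrey_bound x : 0 <= x <= T -> `|g x| <= morrey_const.
Proof.
move=> /andP[x0 xT].
pose r : R := 2^-1.
have r0 : 0 < r by rewrite invr_gt0.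
pose h n : R := T * r ^+ n.
pose a n : R := x - x * r ^+ n.
have rn0 n : 0 < r ^+ n by rewrite exprn_gt0.
have rn1 n : r ^+ n <= 1 by rewrite exprn_ile1 ?ltW// invf_lt1// ltr1n.
have h0 n : 0 < h n by rewrite mulr_gt0.
have sub n : `[a n, a n + h n]%classic `<=` `[0, T]%classic.
  move=> t /=; rewrite !in_itv/= /a /h => /andP[t1 t2].
  have := rn1 n; have := rn0 n; move: t1 t2; set y := r ^+ n => t1 t2 y0 y1.
  by apply/andP; split; nra.
have subS n : `[a n.+1, a n.+1 + h n.+1]%classic `<=` `[a n, a n + h n]%classic.
  move=> t /=; rewrite !in_itv/= /a /h exprSr /r => /andP[t1 t2].
  have := rn0 n; move: t1 t2; set y := r ^+ n => t1 t2 y0.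
  by apply/andP; split; nra.
have [s sI sB] : exists2 s : nat -> R, forall n, s n \in `[a n, a n + h n] &
    forall n, (\int[mu]_(t in `[a n, (a n + h n)%R]) `|g (s n) - g t|%:E
     <= (4 * (h n `^ beta * h n))%:E)%E.
  have /choice[s Hs] : forall n, exists s, s \in `[a n, a n + h n] /\
    (\int[mu]_(t in `[a n, (a n + h n)%R]) `|g s - g t|%:E
     <= (4 * (h n `^ beta * h n))%:E)%E.
    by move=> n; have [s ? ?] := ex_center (h0 n) (sub n); exists s.
  by exists s => n; have [] := Hs n.
pose q := r `^ beta.
have q0 : 0 < q by exact: powR_gt0.
have q1 : q < 1.
  suff : q < 1 `^ beta by rewrite powR1.
  apply: gt0_ltr_powR; rewrite ?nnegrE ?ltW//.
  by rewrite invf_lt1// ltr1n.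
have hb n : h n `^ beta = T `^ beta * q ^+ n.
  rewrite powRM ?ltW//; congr (_ * _).
  by rewrite -(powR_mulrn n (ltW r0)) -(powR_mulrn n (ltW q0)) powRAC.
have step n : `|g (s n) - g (s n.+1)| <= 12 * T `^ beta * q ^+ n.
  have h1 : (\int[mu]_(t in `[a n.+1, (a n.+1 + h n.+1)%R]) `|g (s n) - g t|%:E
     <= (4 * (h n `^ beta * h n))%:E)%E.
    apply: le_trans (sB n); apply: ge0_subset_integral => //.
    apply: measurable_funTS; apply/measurable_EFinP.
    by apply: measurableT_comp => //; exact: measurable_funB.
  have := dist_le_integral (h0 n.+1) h1 (sB n.+1).
  rewrite !hb; have -> : h n = 2 * h n.+1 by rewrite /h exprSr /r; field.
  rewrite exprSr; have := h0 n.+1.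
  have Tb : 0 < T `^ beta by exact: powR_gt0.
  have qn : 0 < q ^+ n by exact: exprn_gt0.
  set D := `|_ - _|; set hn := h n.+1; set y := q ^+ n in qn *.
  set tb := T `^ beta in Tb *.
  move=> hn0 H.
  have : D * hn <= (12 * tb * y) * hn.
    apply: (le_trans H).
    have : 0 <= tb * y * (1 - q) * hn.
      by rewrite !mulr_ge0 ?subr_ge0 ?ltW.
    lra.
  by rewrite ler_pM2r.
have base : `|g (s 0%N)| <= 4 * T `^ beta + (T + 1) / T.
  have h00 : h 0%N = T by rewrite /h expr0 mulr1.
  have a00 : a 0%N = 0 by rewrite /a expr0 mulr1 subrr.
  have := sB 0%N; rewrite h00 a00 add0r => H1.
  have H2 : (\int[mu]_(t in `[0%R, T]) `|0 - g t|%:E <= (T + 1)%:E)%E.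
    apply: (@le_trans _ _ (\int[mu]_(t in `[0%R, T])
      (cst 1%:E t + (1 * `|g t| `^ p)%:E)))%E.
      apply: ge0_le_integral_nomeas => // t _.
      rewrite -EFinD lee_fin sub0r normrN mul1r.
      have [g1|/ltW g1] := leP `|g t| 1.
        by apply: ler_wpDr => //; exact: powR_ge0.
      by apply: ler_wpDl => //; apply: le1r_powR => //; exact: ltW.
    rewrite ge0_integralD//; last first.
      apply: (@measurable_modular_integrand _ _ _ _ (fun=> 1)) => //.
      exact: measurable_funTS.
    rewrite integral_cst// EFinD; apply: leeD => //.
    by have := lebesgue_itvcc 0 (ltW T0); rewrite add0r mul1e /= => ->.
  have := @dist_le_integral 0 T (g (s 0%N)) 0 _ _ T0.
  rewrite add0r => /(_ _ _ H1 H2); rewrite subr0 -ler_pdivlMr//.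
  move=> /le_trans; apply; rewrite mulrDl lerD2r.
  by rewrite !mulrA mulfK// gt_eqF.
have sum n : `|g (s n)| <= morrey_const.
  suff H : `|g (s n)| <= `|g (s 0%N)| + 12 * T `^ beta * \sum_(i < n) q ^+ i.
    apply: (le_trans H); apply: lerD => //.
    apply: ler_wpM2l; first by rewrite mulr_ge0 ?powR_ge0.
    rewrite -[X in _ <= X]div1r ler_pdivlMr ?subr_gt0//.
    rewrite mulrC -[1 - q]opprB mulNr -subrX1 opprB.
    by rewrite gerBl exprn_ge0// ltW.
  elim: n => [|n IH]; first by rewrite big_ord0 mulr0 addr0.
  rewrite big_ord_recr/= mulrDr addrA.
  have -> : g (s n.+1) = g (s n) - (g (s n) - g (s n.+1)) by ring.
  apply: (le_trans (ler_normB _ _)); exact: lerD.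
have sx : s n @[n --> \oo] --> x.
  have hx n : x - h n <= s n <= x + h n.
    have := sI n; rewrite in_itv/= /a /h => /andP[t1 t2].
    have := rn0 n; move: t1 t2; set y := r ^+ n => t1 t2 y0.
    by apply/andP; split; nra.
  have hl : h n @[n --> \oo] --> 0.
    rewrite -[X in _ --> X](mulr0 T); apply: cvgM; first exact: cvg_cst.
    by apply: cvg_expr; rewrite gtr0_norm// invf_lt1// ltr1n.
  apply: (@squeeze_cvgr _ _ _ _ (fun n => x - h n) (fun n => x + h n)).
  - exact: nearW.
  - by rewrite -[X in _ --> X]subr0; apply: cvgB => //; exact: cvg_cst.
  - by rewrite -[X in _ --> X]addr0; apply: cvgD => //; exact: cvg_cst.
have gsx : `|g (s n)| @[n --> \oo] --> `|g x|.
  have gs : g (s n) @[n --> \oo] --> g x := cvg_comp s g sx (@cg x).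
  exact: cvg_norm gs.
rewrite -(cvg_lim _ gsx)//; apply: limr_le; first by apply/cvg_ex; exists `|g x|.
exact: nearW.
Qed.

End Morrey.

(** * The Sobolev modular of a scalar function *)

Section Clamp.
Context {R : realType}.
Variable T : R.
Hypothesis T0 : 0 <= T.

Fact clamp_subproof (t : R) : Num.max 0 (Num.min t T) \in `[0, T]%classic.
Proof.
apply/mem_set; rewrite /= in_itv/= le_max lexx/= ge_max T0/=.
by rewrite ge_min lexx orbT.
Qed.

(** Composing with the projection of the line onto [0, T] turns a path into a
function on the line that is continuous, so that measurability is immediate. *)
Definition clamp (t : R) : time T := SigSub (clamp_subproof t).

Lemma val_clamp t : 0 <= t <= T -> val (clamp t) = t.
Proof. by move=> /andP[t0 tT] /=; rewrite (min_idPl tT) (max_idPr t0). Qed.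

Lemma time_itv (s : time T) : 0 <= val s <= T.
Proof. by have := set_valP s; rewrite /= in_itv. Qed.

Lemma clampK (s : time T) : clamp (val s) = s.
Proof. by apply/val_inj; rewrite val_clamp// time_itv. Qed.

Lemma clamp_lipschitz s t : `|val (clamp t) - val (clamp s)| <= `|t - s|.
Proof.
have := ler_norm (t - s); have := ler_norm (s - t).
rewrite (distrC s) /= => st ts; rewrite ler_norml.
by case: (leP s T) => ?; case: (leP t T) => ?;
  case: (leP 0 s) => ?; case: (leP 0 t) => ?; case: (leP 0 T) => ?;
  apply/andP; split; lra.
Qed.

Lemma valL_clamp (V : Type) (v : V) (h : time T -> V) t : 0 <= t <= T ->
  'valL_ v h t = h (clamp t).
Proof.
move=> tT; rewrite -[in LHS](val_clamp tT).
exact: (congr1 (fun g => g (clamp t)) (valLK v h)).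
Qed.

End Clamp.

Section SobolevModular.
Context {R : realType}.
Variables (T alpha p : R).
Hypotheses (T0 : 0 < T) (p1 : 1 < p) (alphap : p^-1 < alpha).
Local Notation mu := (@lebesgue_measure R).
Implicit Types g h : R -> R.

Let p0 : 0 < p. Proof. exact: lt_trans ltr01 p1. Qed.

Definition sobolev_modular g : \bar R :=
  (modular mu `[0%R, T]%classic (fun=> 1%R) p g
   + modular (mu \x mu) (square T) (sobolev_weight alpha p) p (increment g))%E.

Let w1 : forall z : R, (0 : R) <= (fun=> 1) z. Proof. by move=> z. Qed.
Let w2 : forall z : R * R, 0 <= sobolev_weight alpha p z.
Proof. exact: sobolev_weight_ge0. Qed.
Let mD1 : measurable (`[0, T]%classic : set R). Proof. exact: measurable_itv. Qed.
Let mD2 : measurable (square T). Proof. exact: measurable_square. Qed.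
Let mw1 : measurable_fun `[0, T]%classic (fun=> 1 : R). Proof. by []. Qed.
Let mw2 : measurable_fun (square T) (sobolev_weight alpha p).
Proof. exact: measurable_sobolev_weight. Qed.

Let m1_ge0 g : (0 <= modular mu `[0%R, T]%classic (fun=> 1%R) p g)%E.
Proof. by apply: modular_ge0. Qed.

Let m2_ge0 f :
  (0 <= modular (mu \x mu) (square T) (sobolev_weight alpha p) p f)%E.
Proof. by apply: modular_ge0. Qed.

Let mc g : continuous g -> measurable_fun `[0, T]%classic g.
Proof.
by move=> cg; apply: measurable_funTS; exact: continuous_measurable_fun.
Qed.

Let mi g : continuous g -> measurable_fun (square T) (increment g).
Proof.
by move=> cg; apply: measurable_increment; exact: continuous_measurable_fun.
Qed.

Let mulE k g : (k * sobolev_modular g =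
  k * modular mu `[0%R, T]%classic (fun=> 1%R) p g +
  k * modular (mu \x mu) (square T) (sobolev_weight alpha p) p (increment g))%E.
Proof. by rewrite /sobolev_modular ge0_muleDr. Qed.

Lemma sobolev_modular_ge0 g : (0 <= sobolev_modular g)%E.
Proof. exact: adde_ge0. Qed.

Lemma sobolev_modular_scale (c : R) g : continuous g ->
  sobolev_modular (fun t => c * g t) = ((`|c| `^ p)%:E * sobolev_modular g)%E.
Proof.
move=> cg; rewrite mulE.
have -> : sobolev_modular (fun t => c * g t) =
    (modular mu `[0%R, T]%classic (fun=> 1%R) p (fun t => (c * g t)%R) +
     modular (mu \x mu) (square T) (sobolev_weight alpha p) p
       (fun z => (c * increment g z)%R))%E.
  congr (_ + modular _ _ _ _ _)%E.
  by apply/funext => z; rewrite /increment mulrBr.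
apply: (f_equal2 adde).
  by apply: modular_scale; last exact: mc.
by apply: modular_scale; last exact: mi.
Qed.

Lemma sobolev_modular_triangle g h : continuous g -> continuous h ->
  (sobolev_modular (fun t => g t + h t)%R
   <= (2 `^ p)%:E * sobolev_modular g + (2 `^ p)%:E * sobolev_modular h)%E.
Proof.
move=> cg ch; rewrite [X in (_ <= X + _)%E]mulE.
rewrite [X in (_ <= _ + X)%E]mulE.
rewrite addeACA; apply: leeD.
  by apply: modular_triangle => //; exact: mc.
have -> : increment (fun t => g t + h t) =
    fun z => increment g z + increment h z.
  by apply/funext => z; rewrite /increment; ring.
by apply: modular_triangle => //; exact: mi.
Qed.

Lemma sobolev_modular_uniform_convexity (e C : R) g h : 0 <= e -> 0 <= C ->
  (forall a b : R, `|a - b| `^ p + C * `|(a + b) / 2| `^ p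
    <= (e + C / 2) * (`|a| `^ p + `|b| `^ p)) ->
  continuous g -> continuous h ->
  (sobolev_modular (fun t => g t - h t)%R
     + C%:E * sobolev_modular (fun t => (g t + h t) / 2)%R
   <= (e + C / 2)%:E * sobolev_modular g + (e + C / 2)%:E * sobolev_modular h)%E.
Proof.
move=> e0 C0 H cg ch; rewrite [X in (_ + X <= _)%E]mulE.
rewrite [X in (_ <= X + _)%E]mulE [X in (_ <= _ + X)%E]mulE.
rewrite addeACA [leRHS]addeACA; apply: leeD.
  by apply: modular_uniform_convexity => //; exact: mc.
have := modular_uniform_convexity (mu \x mu)%E mD2 w2 mw2 e0 C0 H (mi cg) (mi ch).
have -> : (fun z => increment g z - increment h z) =
    increment (fun t => g t - h t).
  by apply/funext => z; rewrite /increment; ring.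
have -> : (fun z => (increment g z + increment h z) / 2) =
    increment (fun t => (g t + h t) / 2).
  by apply/funext => z; rewrite /increment; field.
exact.
Qed.

(** Fatou's lemma is applied to the two halves separately, whence the factor 2. *)
Lemma sobolev_modular_fatou (h_ : nat -> R -> R) h (c : \bar R) :
  (forall n, continuous (h_ n)) ->
  (forall t, 0 <= t <= T -> h_ n t @[n --> \oo] --> h t) ->
  (exists n0, forall n, (n0 <= n)%N -> sobolev_modular (h_ n) <= c)%E ->
  (sobolev_modular h <= c + c)%E.
Proof.
move=> ch hc [n0 H]; apply: leeD.
  apply: (@modular_fatou _ _ _ mu _ _ p mD1 w1 mw1 p1 h_).
  - by move=> n; exact: mc.
  - by move=> z /=; rewrite in_itv; exact: hc.
  - exists n0 => n /H; apply: le_trans; rewrite /sobolev_modular.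
    exact: leeDl.
apply: (@modular_fatou _ _ _ (mu \x mu)%E _ _ p mD2 w2 mw2 p1
  (fun n => increment (h_ n))).
- by move=> n; exact: mi.
- move=> z /= []; rewrite /= !in_itv/= => z1 z2.
  by apply: cvgB; exact: hc.
- exists n0 => n /H; apply: le_trans; rewrite /sobolev_modular.
  by exact: leeDr.
Qed.

(** The Morrey estimate at unit modular, rescaled. *)
Lemma sobolev_modular_sup (eta : R) : 0 < eta -> exists2 delta : R, 0 < delta &
  forall g, continuous g -> (sobolev_modular g <= delta%:E)%E ->
    forall t, 0 <= t <= T -> `|g t| <= eta.
Proof.
move=> eta0; set M := Num.max 1 (morrey_const T alpha p).
have M0 : 0 < M by rewrite lt_max ltr01.
have c0 : 0 < M / eta by rewrite divr_gt0.
exists (((M / eta) `^ p)^-1); first by rewrite invr_gt0 powR_gt0.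
move=> g cg gd t tT.
have cg' : continuous (fun t => M / eta * g t).
  by move=> x; apply: cvgM; [exact: cvg_cst|exact: cg].
have : (sobolev_modular (fun t => (M / eta * g t)%R) <= 1)%E.
  rewrite sobolev_modular_scale// gtr0_norm//.
  rewrite -(@mulfV _ ((M / eta) `^ p)) ?gt_eqF ?powR_gt0// EFinM.
  by apply: lee_wpmul2l => //; rewrite lee_fin powR_ge0.
rewrite /sobolev_modular => H.
have H1 : (modular mu `[0%R, T]%classic (fun=> 1%R) p
    (fun t => (M / eta * g t)%R) <= 1)%E.
  apply: le_trans H; exact: leeDl.
have H2 : (modular (mu \x mu) (square T) (sobolev_weight alpha p) p
    (increment (fun t => (M / eta * g t)%R)) <= 1)%E.
  apply: le_trans H; exact: leeDr.
have := morrey_bound T0 p1 alphap cg' H1 H2 tT.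
rewrite normrM gtr0_norm// => H3.
have : M / eta * `|g t| <= M / eta * eta.
  by apply: (le_trans H3); rewrite divfK ?gt_eqF// le_max lexx orbT.
by rewrite ler_pM2l.
Qed.

End SobolevModular.

(** * Vector-valued paths *)

Section EnormPower.
Context {R : realType}.

Lemma enorm_le_sum (I : finType) (v : I -> R) : enorm v <= \sum_i `|v i|.
Proof.
have S0 : 0 <= \sum_i `|v i| by exact: sumr_ge0.
rewrite /enorm -[leRHS]ger0_norm// -sqrtr_sqr ler_sqrt ?sqr_ge0//.
rewrite expr2 mulr_suml; apply: ler_sum => i _.
rewrite -real_normK ?num_real// expr2; apply: ler_wpM2l => //.
by rewrite (bigD1 i)//= lerDl; exact: sumr_ge0.
Qed.

Lemma enorm_powR_le (I : finType) (v : I -> R) (p : R) : 1 < p ->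
  enorm v `^ p <= #|I|%:R `^ p * \sum_i `|v i| `^ p.
Proof.
move=> p1; have p0 : 0 < p by exact: lt_trans ltr01 p1.
set S := \sum_i `|v i| `^ p.
have S0 : 0 <= S by apply: sumr_ge0 => *; exact: powR_ge0.
have -> : S = (S `^ p^-1) `^ p by rewrite -powRrM mulVf ?powRr1// gt_eqF.
rewrite -powRM ?powR_ge0//; apply: le_powR2l => //; first exact: enorm_ge0.
apply: (le_trans (enorm_le_sum v)).
rewrite mulr_natl -sumr_const; apply: ler_sum => i _.
have -> : `|v i| = (`|v i| `^ p) `^ p^-1.
  by rewrite -powRrM mulfV ?powRr1// gt_eqF.
apply: ge0_ler_powR; rewrite ?nnegrE ?powR_ge0 ?invr_ge0 ?(ltW p0)//.
by rewrite /S (bigD1 i)//= lerDl; apply: sumr_ge0 => *; exact: powR_ge0.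
Qed.

End EnormPower.

Section ModularEnorm.
Context d (X : measurableType d) {R : realType}.
Variables (mu : {measure set X -> \bar R}) (D : set X) (w : X -> R) (p : R).
Hypothesis mD : measurable D.
Hypothesis w0 : forall z, 0 <= w z.
Hypothesis mw : measurable_fun D w.
Hypothesis p1 : 1 < p.
Variables (I : finType) (h : X -> I -> R).
Hypothesis mh : forall i, measurable_fun D (fun z => h z i).

Lemma modular_coord_le i :
  (modular mu D w p (fun z => h z i)
   <= modular mu D w p (fun z => enorm (h z)))%E.
Proof.
apply: le_modular => // z _; rewrite [leRHS]ger0_norm ?enorm_ge0//.
exact: ge_coord_enorm.
Qed.

Lemma modular_enorm_le :
  (modular mu D w p (fun z => enorm (h z)) <=
   (#|I|%:R `^ p)%:E * \sum_i modular mu D w p (fun z => h z i))%E.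
Proof.
have I0 i z : D z -> (0 <= (w z * `|h z i| `^ p)%:E)%E.
  by rewrite lee_fin mulr_ge0// powR_ge0.
have mI i : measurable_fun D (fun z => (w z * `|h z i| `^ p)%:E).
  exact: measurable_modular_integrand.
rewrite /modular -ge0_integral_sum// -ge0_integralZl_EFin ?powR_ge0//;
  last 2 first.
- by move=> z Dz; apply: sume_ge0 => i _; exact: I0.
- exact: emeasurable_sum.
apply: ge0_le_integral_nomeas => z Dz.
  by rewrite lee_fin mulr_ge0// powR_ge0.
rewrite sumEFin -EFinM lee_fin -mulr_sumr mulrCA; apply: ler_wpM2l => //.
by rewrite ger0_norm ?enorm_ge0//; exact: enorm_powR_le.
Qed.

End ModularEnorm.

Section VectorPaths.
Context {R : realType}.
Variables (T alpha p : R).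
Hypotheses (T0 : 0 < T) (p1 : 1 < p) (alphap : p^-1 < alpha).
Variable I : finType.
Local Notation mu := (@lebesgue_measure R).
Local Notation path := (time T -> {ffun I -> R^o}).
Implicit Types f g : path.

Let p0 : 0 < p. Proof. exact: lt_trans ltr01 p1. Qed.

Definition path_coord f (i : I) (t : R) : R := f (clamp (ltW T0) t) i.

(** Summing over coordinates, instead of using the Euclidean norm of the values,
reduces uniform convexity and the Morrey estimate to scalar functions. *)
Definition path_modular f : \bar R :=
  (\sum_i sobolev_modular T alpha p (path_coord f i))%E.

Lemma path_modular_ge0 f : (0 <= path_modular f)%E.
Proof. by apply: sume_ge0 => i _; exact: sobolev_modular_ge0. Qed.

Lemma coord_modular_le f i :
  (sobolev_modular T alpha p (path_coord f i) <= path_modular f)%E.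
Proof.
rewrite /path_modular (bigD1 i)//=; apply: leeDl.
by apply: sume_ge0 => j _; exact: sobolev_modular_ge0.
Qed.

Lemma sobolev_energyE f : sobolev_energy alpha p (@euclid_dist R I) f =
  modular (mu \x mu)%E (square T) (sobolev_weight alpha p) p
    (fun z => enorm (fun i => increment (path_coord f i) z)).
Proof.
rewrite /sobolev_energy /time_integral2 /modular.
apply: eq_integral => -[s t] /set_mem[sT' tT'].
have sT : 0 <= s <= T by move: sT'; rewrite /= in_itv.
have tT : 0 <= t <= T by move: tT'; rewrite /= in_itv.
rewrite [(s, t).1]/= [(s, t).2]/=.
rewrite (valL_clamp (ltW T0))// (valL_clamp (ltW T0))//.
rewrite /euclid_dist poweR_EFin -EFinM mulrC (ger0_norm (enorm_ge0 _)).
rewrite (val_clamp (ltW T0) sT) (val_clamp (ltW T0) tT).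
congr ((_ * enorm _ `^ _)%:E).
by apply/funext => i; rewrite !ffunE.
Qed.

Lemma time_integralE f :
  time_integral (fun t : time T => (enorm (f t) `^ p)%:E) =
  modular mu `[0%R, T]%classic (fun=> 1%R) p (fun z => enorm (path_coord f ^~ z)).
Proof.
apply: eq_integral => t /set_mem tT'.
have tT : 0 <= t <= T by move: tT'; rewrite /= in_itv.
by rewrite (valL_clamp (ltW T0))// mul1r (ger0_norm (enorm_ge0 _)).
Qed.

Definition path_continuous f := forall s (e : R), 0 < e ->
  exists2 delta : R, 0 < delta & forall t, `|val t - val s| < delta ->
    (euclid_dist (f s) (f t) < e%:E)%E.

Lemma path_continuousP f :
  path_continuous f <-> forall i, continuous (path_coord f i).
Proof.
split=> [fc i t|fc s e e0].
  apply/cvgrPdist_lt => e e0; have [dl dl0 H] := fc (clamp (ltW T0) t) e e0.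
  exists dl => // u /= tu; apply: (@le_lt_trans _ _
    (enorm (f (clamp (ltW T0) t) - f (clamp (ltW T0) u)))).
    have := ge_coord_enorm (f (clamp (ltW T0) t) - f (clamp (ltW T0) u)) i.
    by rewrite !ffunE.
  rewrite -lte_fin; apply: H; apply: le_lt_trans tu.
  rewrite [leRHS]distrC; exact: clamp_lipschitz.
have e'0 : 0 < e / (#|I|%:R + 1) by rewrite divr_gt0// ltr_wpDl.
have H i : exists2 dl : R, 0 < dl & forall t, `|val t - val s| < dl ->
    `|f s i - f t i| < e / (#|I|%:R + 1).
  have /cvgrPdist_lt /(_ _ e'0) [dl /= dl0 Hd] := fc i (val s).
  exists dl => // t ts; have := Hd (val t).
  by rewrite /= distrC /path_coord !clampK; apply.
have /fin_all_exists[dl Hdl] : forall i, exists dl : R, 0 < dl /\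
    forall t, `|val t - val s| < dl -> `|f s i - f t i| < e / (#|I|%:R + 1).
  by move=> i; have [dl ? ?] := H i; exists dl.
exists (\big[Num.min/1]_i dl i).
  by apply: lt_bigmin => // i _; exact: (Hdl i).1.
move=> t ts; rewrite lte_fin; apply: (le_lt_trans (enorm_le_sum _)).
apply: (@le_lt_trans _ _ (\sum_(i : I) e / (#|I|%:R + 1))).
  apply: ler_sum => i _; rewrite !ffunE; apply/ltW/(Hdl i).2.
  by apply: (lt_le_trans ts); exact: bigmin_le_cond.
rewrite sumr_const -[X in X < _]mulr_natl mulrCA gtr_pMr//.
by rewrite ltr_pdivrMr ?mul1r ?ltrDl// ltr_wpDl.
Qed.

Lemma modular_itv_fin (g : R -> R) : continuous g ->
  (modular mu `[0%R, T]%classic (fun=> 1%R) p g < +oo)%E.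
Proof.
move=> cg.
have [c cI cmax] : exists2 c, c \in `[0, T] & forall t, t \in `[0, T] ->
    `|g t| <= `|g c|.
  apply: (@EVT_max R (fun t => `|g t|)); first exact: ltW.
  apply: continuous_subspaceT => t.
  have K : g u @[u --> t] --> g t by exact: cg.
  exact: cvg_norm K.
apply: (@le_lt_trans _ _
  (\int[mu]_(z in `[0%R, T]) cst (`|g c| `^ p)%:E z)%E).
  apply: ge0_le_integral_nomeas => z zT; rewrite lee_fin.
    by rewrite mulr_ge0// powR_ge0.
  by rewrite mul1r; apply: le_powR2l => //; exact: cmax.
rewrite integral_cst//=.
have := lebesgue_itvcc 0 (ltW T0); rewrite add0r /= => ->.
by rewrite -EFinM ltry.
Qed.

Section Continuous.
Variable f : path.
Hypothesis fc : forall i, continuous (path_coord f i).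

Let A := time_integral (fun t : time T => (enorm (f t) `^ p)%:E).
Let B := sobolev_energy alpha p (@euclid_dist R I) f.

Let mc i : measurable_fun `[0, T]%classic (path_coord f i).
Proof. by apply: measurable_funTS; apply: continuous_measurable_fun. Qed.

Let mi i : measurable_fun (square T) (increment (path_coord f i)).
Proof.
by apply: measurable_increment; apply: continuous_measurable_fun.
Qed.

Let mw : measurable_fun (square T) (sobolev_weight alpha p).
Proof. exact: measurable_sobolev_weight. Qed.

Let w2 : forall z : R * R, 0 <= sobolev_weight alpha p z.
Proof. exact: sobolev_weight_ge0. Qed.

Lemma time_integral_le_modular :
  (A <= (#|I|%:R `^ p)%:E * path_modular f)%E.
Proof.
rewrite /A time_integralE.
apply: (@le_trans _ _ ((#|I|%:R `^ p)%:E *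
  \sum_i modular mu `[0%R, T]%classic (fun=> 1%R) p (path_coord f i))%E).
  exact: (@modular_enorm_le _ _ _ mu _ _ _ _ _ _ p1 _
    (fun z i => path_coord f i z)).
apply: lee_wpmul2l; first by rewrite lee_fin powR_ge0.
by apply: lee_sum => i _; apply: leeDl; apply: modular_ge0.
Qed.

Lemma energy_le_modular : (B <= (#|I|%:R `^ p)%:E * path_modular f)%E.
Proof.
rewrite /B sobolev_energyE.
apply: (@le_trans _ _ ((#|I|%:R `^ p)%:E *
  \sum_i modular (mu \x mu) (square T) (sobolev_weight alpha p) p
    (increment (path_coord f i)))%E).
  apply: (@modular_enorm_le _ _ _ (mu \x mu)%E _ _ _ _ w2 mw p1 _
    (fun z i => increment (path_coord f i) z) mi).
  exact: measurable_square.
apply: lee_wpmul2l; first by rewrite lee_fin powR_ge0.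
by apply: lee_sum => i _; apply: leeDr; apply: modular_ge0.
Qed.

Lemma modular_le_norms : (path_modular f <= #|I|%:R%:E * (A + B))%E.
Proof.
rewrite /path_modular /A /B time_integralE sobolev_energyE.
apply: (@le_trans _ _ (\sum_(i : I) (A + B))%E).
  rewrite /A /B time_integralE sobolev_energyE.
  apply: lee_sum => i _; apply: leeD.
    exact: (@modular_coord_le _ _ _ mu _ _ _ _ p1 _
      (fun z i => path_coord f i z)).
  exact: (@modular_coord_le _ _ _ (mu \x mu)%E _ _ _ w2 p1 _
    (fun z i => increment (path_coord f i) z)).
have AB0 : (0 <= A + B)%E.
  rewrite /A /B time_integralE sobolev_energyE.
  by apply: adde_ge0; exact: modular_ge0.
rewrite /A /B time_integralE sobolev_energyE in AB0 *.
rewrite big_const; elim: #|_| => [|n IH]; first by rewrite mul0e.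
rewrite iterS -natr1 EFinD ge0_muleDl// mul1e addeC; exact: leeD.
Qed.

Lemma time_integral_fin : (A < +oo)%E.
Proof.
rewrite /A time_integralE.
apply: (@le_lt_trans _ _ ((#|I|%:R `^ p)%:E *
  \sum_i modular mu `[0%R, T]%classic (fun=> 1%R) p (path_coord f i))%E).
  exact: (@modular_enorm_le _ _ _ mu _ _ _ _ _ _ p1 _
    (fun z i => path_coord f i z)).
apply: lte_mul_pinfty => //.
apply/lte_sum_pinfty => i _; exact: modular_itv_fin.
Qed.

End Continuous.

Lemma sobolev_spaceP f : sobolev_space alpha p I f <->
  (forall i, continuous (path_coord f i)) /\ (path_modular f < +oo)%E.
Proof.
split=> [[_ /path_continuousP fc Ef]|[fc Pf]].
  split=> //; apply: (le_lt_trans (modular_le_norms f)).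
  apply: lte_mul_pinfty => //.
  by apply: lte_add_pinfty => //; exact: time_integral_fin.
split=> //; first exact/path_continuousP.
apply: (le_lt_trans (energy_le_modular fc)).
by apply: lte_mul_pinfty => //; rewrite lee_fin powR_ge0.
Qed.

Lemma time_integral_ge0 f :
  (0 <= time_integral (fun t : time T => (enorm (f t) `^ p)%:E))%E.
Proof. rewrite time_integralE; exact: modular_ge0. Qed.

Lemma energy_ge0 f : (0 <= sobolev_energy alpha p (@euclid_dist R I) f)%E.
Proof.
rewrite sobolev_energyE; apply: modular_ge0 => z; exact: sobolev_weight_ge0.
Qed.

Lemma sobolev_normE f : sobolev_space alpha p I f ->
  sobolev_norm alpha p I f =
  fine (time_integral (fun t : time T => (enorm (f t) `^ p)%:E)) `^ p^-1 +
  fine (sobolev_energy alpha p (@euclid_dist R I) f) `^ p^-1.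
Proof.
move=> [_ /path_continuousP fc Ef].
rewrite /sobolev_norm fineD ?fine_poweR// ge0_fin_numE ?poweR_ge0//.
  by apply: poweR_lty; exact: time_integral_fin.
exact: poweR_lty.
Qed.

(** This and the next lemma are the equivalence of the Sobolev norm with the
p-th root of the modular: the first transports coercivity, the second lower
semi-continuity. *)
Lemma modular_le_sobolev_norm f (M : R) : sobolev_space alpha p I f ->
  sobolev_norm alpha p I f <= M ->
  fine (path_modular f) <= #|I|%:R * (M `^ p + M `^ p).
Proof.
move=> Wf; rewrite sobolev_normE// => nM.
have [fc Pf] := (sobolev_spaceP f).1 Wf.
have [_ _ Bf] := Wf; have Af := time_integral_fin fc.
have A0 := time_integral_ge0 f; have B0 := energy_ge0 f.
have := modular_le_norms f.
set A := time_integral _ in nM Af A0 *.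
set B := sobolev_energy _ _ _ _ in nM Bf B0 *.
rewrite -lee_fin fineK ?ge0_fin_numE ?path_modular_ge0// => /le_trans; apply.
rewrite EFinM; apply: lee_wpmul2l => //; rewrite EFinD.
have root (x : \bar R) : (0 <= x)%E -> (x < +oo)%E ->
    fine x `^ p^-1 <= M -> (x <= (M `^ p)%:E)%E.
  move=> x0 xf xM; rewrite -(fineK (x := x)) ?ge0_fin_numE// lee_fin.
  have -> : fine x = (fine x `^ p^-1) `^ p.
    by rewrite -powRrM mulVf ?gt_eqF// powRr1// fine_ge0.
  by apply: le_powR2l => //; exact: powR_ge0.
apply: leeD; apply: root => //; apply: le_trans nM.
  by rewrite lerDl powR_ge0.
by rewrite lerDr powR_ge0.
Qed.

Lemma sobolev_norm_le_modular f (dl : R) : sobolev_space alpha p I f ->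
  fine (path_modular f) <= dl ->
  sobolev_norm alpha p I f <= 2 * (#|I|%:R `^ p * dl) `^ p^-1.
Proof.
move=> Wf Pd; rewrite sobolev_normE//.
have [fc Pf] := (sobolev_spaceP f).1 Wf.
have root (x : \bar R) : (0 <= x)%E ->
    (x <= (#|I|%:R `^ p)%:E * path_modular f)%E ->
    fine x `^ p^-1 <= (#|I|%:R `^ p * dl) `^ p^-1.
  move=> x0 xle.
  have Pfin : path_modular f \is a fin_num.
    by rewrite ge0_fin_numE ?path_modular_ge0.
  have {}xle : (x <= (#|I|%:R `^ p * dl)%:E)%E.
    apply: (le_trans xle); rewrite EFinM; apply: lee_wpmul2l.
      by rewrite lee_fin powR_ge0.
    by rewrite -(fineK Pfin) lee_fin.
  have xfin : x \is a fin_num by rewrite ge0_fin_numE// (le_lt_trans xle)// ltry.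
  have xr : fine x <= #|I|%:R `^ p * dl by rewrite -lee_fin fineK.
  apply: ge0_ler_powR; rewrite ?nnegrE ?fine_ge0 ?invr_ge0 ?(ltW p0)//.
  exact: le_trans (fine_ge0 x0) xr.
rewrite mulr_natl mulr2n; apply: lerD; apply: root.
- exact: time_integral_ge0.
- exact: time_integral_le_modular.
- exact: energy_ge0.
- exact: energy_le_modular.
Qed.

End VectorPaths.

(** * Minimizers of convex functionals under a uniformly convex modular *)

Section NestedConvexSets.
Context {R : realType} {E : lmodType R}.
Variables (W : set E) (Psi : E -> R).
Local Notation mid f g := (2^-1 *: f + (1 - 2^-1) *: g).

(** [Psi] plays the role of the p-th power of a norm.  A small value of
Psi (f - g) is forced by a small convexity defect at the midpoint, up to an
error e that can be chosen in advance. *)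
Definition modular_uniformly_convex := forall e : R, 0 < e ->
  exists2 C : R, 0 <= C & forall f g, W f -> W g ->
    Psi (f - g) + C * Psi (mid f g) <= (e + C / 2) * (Psi f + Psi g).

Definition modular_complete := forall x : nat -> E, (forall n, W (x n)) ->
  (forall e : R, 0 < e -> exists n0, forall n m, (n0 <= n)%N -> (n0 <= m)%N ->
    Psi (x n - x m) <= e) ->
  exists2 y, W y & forall e : R, 0 < e ->
    exists n0, forall n, (n0 <= n)%N -> Psi (x n - y) <= e.

Definition modular_closed (C : set E) := forall (x : nat -> E) y,
  (forall n, C (x n)) -> W y ->
  (forall e : R, 0 < e ->
    exists n0, forall n, (n0 <= n)%N -> Psi (x n - y) <= e) ->
  C y.

Hypotheses (Psi0 : forall f, 0 <= Psi f) (UC : modular_uniformly_convex)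
  (complete : modular_complete).

(** Let d n be the infimum of [Psi] on C n.  It increases to a finite limit l.  If
x n in C n is nearly minimal, the midpoint of x n and x m lies in the larger of
the two sets, so its [Psi] is nearly l while [Psi (x n)] and [Psi (x m)] are at
most nearly l; uniform convexity makes [Psi (x n - x m)] small. *)
Lemma nested_convex_nonempty (C : nat -> set E) (M : R) :
  (forall n, C n `<=` W) -> (forall n, C n !=set0) ->
  (forall n m, (n <= m)%N -> C m `<=` C n) ->
  (forall n f g, C n f -> C n g -> C n (mid f g)) ->
  (forall n, modular_closed (C n)) ->
  (forall f, C 0%N f -> Psi f <= M) ->
  exists x, forall n, C n x.
Proof.
move=> CW Cne Cdec Cmid Ccl CM.
pose d n := inf [set Psi f | f in C n].
have hlb n : has_lbound [set Psi f | f in C n].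
  by exists 0 => _ [f _ <-].
have hinf n : has_inf [set Psi f | f in C n].
  by split=> //; have [f Cf] := Cne n; exists (Psi f); exists f.
have dle n f : C n f -> d n <= Psi f.
  by move=> Cf; apply: ge_inf => //; exists f.
have dinc n m : (n <= m)%N -> d n <= d m.
  move=> nm; apply: lb_le_inf; first exact: (hinf m).1.
  by move=> _ [f Cf <-]; apply: dle; exact: Cdec Cf.
have d0 n : 0 <= d n.
  by apply: lb_le_inf; [exact: (hinf n).1|move=> _ [f _ <-]].
have dM n : d n <= M.
  have [f Cf] := Cne n; apply: (le_trans (dle n f Cf)); apply: CM.
  exact: Cdec Cf.
have M0 : 0 <= M by exact: le_trans (d0 0%N) (dM 0%N).
have /choice[x Hx] : forall n, exists f, C n f /\ Psi f <= d n + n.+1%:R^-1.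
  move=> n; have n0 : 0 < (n.+1%:R : R)^-1 by rewrite invr_gt0.
  by have [_ [f Cf <-] /ltW fd] := inf_adherent n0 (hinf n); exists f.
have dcvg : cvgn d.
  apply: nondecreasing_is_cvgn; first by move=> n m; exact: dinc.
  by exists M => _ [n _ <-].
have dlim n : d n <= limn d.
  by apply: nondecreasing_cvgn_le => // a b; exact: dinc.
have dcv : d n @[n --> \oo] --> limn d by [].
have Cauchy (e : R) : 0 < e -> exists n0, forall n m, (n0 <= n)%N ->
    (n0 <= m)%N -> Psi (x n - x m) <= e.
  move=> e0; set S := 2 * (M + 1).
  have S0 : 0 < S by rewrite /S mulr_gt0// ltr_wpDl.
  have e1 : 0 < e / 2 / S by rewrite !divr_gt0.
  have [K K0 HK] := UC e1.
  (* k <= 1 keeps l + k below M + 1, and 2 K k <= e / 2 *)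
  set k := Num.min 1 (e / 2 / (2 * (K + 1))).
  have K2 : 0 < 2 * (K + 1) by rewrite mulr_gt0// ltr_wpDl.
  have k0 : 0 < k by rewrite lt_min ltr01 !divr_gt0.
  have k1 : k <= 1 by rewrite ge_min lexx.
  have kK : k * (2 * (K + 1)) <= e / 2.
    by rewrite -ler_pdivlMr// ge_min lexx orbT.
  have [n1 _ Hn1] : \forall n \near \oo, limn d - d n < k.
    move/cvgrPdist_lt : dcv => /(_ _ k0); apply: filterS => n.
    by rewrite ger0_norm// subr_ge0.
  have [n2 _ Hn2] : \forall n \near \oo, (n.+1%:R : R)^-1 < k.
    exact: near_infty_natSinv_lt (PosNum k0).
  have lM : limn d <= M by apply: limr_le => //; exact: nearW.
  exists (maxn n1 n2) => n m; rewrite !geq_max => /andP[nn1 nn2] /andP[mn1 mn2].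
  have Wx i : W (x i) by exact: CW (Hx i).1.
  have := HK _ _ (Wx n) (Wx m).
  have top i : (n2 <= i)%N -> Psi (x i) <= limn d + k.
    by move=> i2; apply: (le_trans (Hx i).2); apply: lerD => //; exact/ltW/Hn2.
  have bot : limn d - k <= Psi (mid (x n) (x m)).
    have Cm : C (minn n m) (mid (x n) (x m)).
      apply: Cmid; [apply: (Cdec _ n)|apply: (Cdec _ m)];
        by [rewrite ?geq_minl ?geq_minr|exact: (Hx _).1].
    apply: le_trans (dle _ _ Cm).
    have : limn d - d (minn n m) < k by apply: Hn1; rewrite /= leq_min nn1.
    lra.
  have eS : e / 2 / S * S = e / 2 by rewrite divfK// gt_eqF.
  move: (top n nn2) (top m mn2) eS bot; rewrite {2}/S.
  set b := Psi (mid _ _); set u := Psi (x n); set v := Psi (x m).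
  set l := limn d in lM *; set c := e / 2 / S in e1 *.
  move=> ul vl cS lb.
  have h1 : (c + K / 2) * (u + v) <= (c + K / 2) * ((l + k) + (l + k)).
    by apply: ler_wpM2l; [rewrite addr_ge0// ?divr_ge0// ltW|exact: lerD].
  have h2 : K * (l - k) <= K * b by exact: ler_wpM2l.
  have h3 : c * (l + k) <= c * (M + 1).
    by apply: ler_wpM2l; [exact: ltW|exact: lerD].
  move=> h4; nra.
have [y Wy Hy] := complete (fun n => CW n _ (Hx n).1) Cauchy.
exists y => n.
apply: (Ccl n (fun k => x (n + k)%N)) => //.
  by move=> k; apply: (Cdec n (n + k)%N); [exact: leq_addr|exact: (Hx _).1].
move=> e /Hy[n0 H]; exists n0 => k kn; apply: H.
by apply: leq_trans kn _; exact: leq_addl.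
Qed.


Hypothesis Wmid : forall f g, W f -> W g -> W (mid f g).

(** The sets of elements that do at least as well as the first n terms of a
minimizing sequence are nested; a common point does as well as the infimum. *)
Lemma convex_minimizer (Phi : E -> \bar R) :
  (forall f, W f -> (-oo < Phi f)%E) ->
  (exists2 f, W f & (Phi f < +oo)%E) ->
  convex_on W Phi ->
  (forall a : R, exists M : R,
    forall f, W f -> (Phi f <= a%:E)%E -> Psi f <= M) ->
  (forall a : R, modular_closed [set f | W f /\ (Phi f <= a%:E)%E]) ->
  exists2 f, W f & forall g, W g -> (Phi f <= Phi g)%E.
Proof.
move=> Phiny [f0 Wf0 Phif0] Pconv Pcoer Pcl.
pose S := [set Phi f | f in [set f | W f /\ (Phi f < +oo)%E]].
have [u Su ucv] : {u : nat -> \bar R | (forall i, S (u i)) &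
    u @ \oo --> ereal_inf S}.
  by apply: ereal_inf_seq; apply/set0P; exists (Phi f0), f0.
have /choice[y Hy] : forall n, exists f,
    [/\ W f, Phi f = u n & u n \is a fin_num].
  move=> n; have [f [Wf Pf] <-] := Su n; exists f; split => //.
  by rewrite fin_numE gt_eqF ?Phiny//= lt_eqF.
pose a n := fine (u n).
have ya n : Phi (y n) = (a n)%:E.
  by have [_ -> ufin] := Hy n; rewrite fineK.
pose C n := [set f | W f /\ forall k, (k <= n)%N -> (Phi f <= (a k)%:E)%E].
have [||||||x Cx] := @nested_convex_nonempty C (projT1 (cid (Pcoer (a 0%N)))).
- by move=> n f [].
- elim=> [|n [f [Wf Hf]]].
    exists (y 0%N); split; first by have [] := Hy 0%N.
    by move=> k; rewrite leqn0 => /eqP ->; rewrite ya.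
  have [le|lt] := leP (Phi f) (a n.+1)%:E.
    exists f; split => // k; rewrite leq_eqVlt => /orP[/eqP -> //|].
    by rewrite ltnS; exact: Hf.
  exists (y n.+1); split; first by have [] := Hy n.+1.
  move=> k; rewrite leq_eqVlt => /orP[/eqP ->|]; rewrite ?ya// ltnS => kn.
  by rewrite (le_trans (ltW lt))// Hf.
- move=> n m nm f [Wf Hf]; split => // k kn; apply: Hf; exact: leq_trans nm.
- move=> n f g [Wf Hf] [Wg Hg]; split; first exact: Wmid.
  move=> k kn.
  have h01 : 0 < (2^-1 : R) < 1 by rewrite invr_gt0 ltr0n invf_lt1 ?ltr1n.
  have h1 : 0 <= 1 - (2^-1 : R) by rewrite subr_ge0 ltW//; case/andP: h01.
  apply: (le_trans (Pconv f g 2^-1 Wf Wg h01)).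
  have -> : ((a k)%:E = (2^-1)%:E * (a k)%:E + (1 - 2^-1)%:E * (a k)%:E)%E.
    by rewrite -!EFinM -EFinD -mulrDl addrC subrK mul1r.
  by apply: leeD; apply: lee_wpmul2l; rewrite ?lee_fin ?invr_ge0//;
    [exact: Hf|exact: Hg].
- move=> n z v Cz Wv zv; split => // k kn.
  have [] // := Pcl (a k) z v _ Wv zv.
  by move=> m; have [Wz Hz] := Cz m; split => //; exact: Hz.
- case: cid => M /= HM f [Wf Hf]; apply: HM => //; exact: Hf.
exists x; first by have [] := Cx 0%N.
move=> g Wg; have [Pg|] := ltP (Phi g) +oo%E; last first.
  by move=> gy; apply: le_trans gy; rewrite leey.
apply: (@le_trans _ _ (ereal_inf S)); last first.
  by apply: ereal_inf_lbound; exists g.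
rewrite -(cvg_lim _ ucv)//; apply: lime_ge.
  by apply/cvg_ex; exists (ereal_inf S).
apply: nearW => n; have [_ Hx] := Cx n.
have [_ _ ufin] := Hy n.
by have := Hx n (leqnn n); rewrite /a fineK.
Qed.

End NestedConvexSets.

(** * The Sobolev space of paths *)

Section Combinations.
Context {R : realType}.

Lemma sum_le_combination (I : finType) (a b u v : I -> R) (C k : R) :
  (forall i, a i + C * b i <= k * (u i + v i)) ->
  \sum_i a i + C * \sum_i b i <= k * (\sum_i u i + \sum_i v i).
Proof.
move=> H; rewrite mulr_sumr -!big_split mulr_sumr /=.
by apply: ler_sum => i _; exact: H.
Qed.

Lemma fine_le_combination (a b u v : \bar R) (C k : R) :
  a \is a fin_num -> b \is a fin_num -> u \is a fin_num -> v \is a fin_num ->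
  (a + C%:E * b <= k%:E * u + k%:E * v)%E ->
  fine a + C * fine b <= k * (fine u + fine v).
Proof.
move=> af bf uf vf H; rewrite mulrDr -lee_fin 2!EFinD 3!EFinM !fineK//.
Qed.

End Combinations.

Section PathSpace.
Context {R : realType}.
Variables (T alpha p : R).
Hypotheses (T0 : 0 < T) (p1 : 1 < p) (alphap : p^-1 < alpha).
Variable I : finType.
Local Notation path := (time T -> {ffun I -> R^o}).
Local Notation W := (@sobolev_space R T alpha p I).
Local Notation co := (path_coord T0).
Local Notation sm := (sobolev_modular T alpha p).
Implicit Types f g : path.

Let p0 : 0 < p. Proof. exact: lt_trans ltr01 p1. Qed.

Definition path_energy f : R := fine (path_modular alpha p T0 f).

Lemma path_energy_ge0 f : 0 <= path_energy f.
Proof. by apply: fine_ge0; exact: path_modular_ge0. Qed.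

Lemma coordB f g i : co (f - g) i = fun t => co f i t - co g i t.
Proof. by apply/funext => t; rewrite /path_coord !ffunE. Qed.

Lemma coord_mid f g i : co (2^-1 *: f + (1 - 2^-1) *: g) i =
  fun t => (co f i t + co g i t) / 2.
Proof.
apply/funext => t; rewrite /path_coord !ffunE /= .
by rewrite /GRing.scale /=; field.
Qed.

Lemma path_modular_fin f : W f -> path_modular alpha p T0 f \is a fin_num.
Proof.
move=> /(sobolev_spaceP alpha T0 p1)[_ ?].
by rewrite ge0_fin_numE ?path_modular_ge0.
Qed.

Lemma coord_continuous f i : W f -> continuous (co f i).
Proof. by move=> /(sobolev_spaceP alpha T0 p1)[fc _]; exact: fc. Qed.

Lemma coord_modular_fin f i : W f -> sm (co f i) \is a fin_num.
Proof.
move=> /path_modular_fin ff; rewrite ge0_fin_numE ?sobolev_modular_ge0//.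
rewrite (le_lt_trans (coord_modular_le _ _ _ _ i))//.
by rewrite -ge0_fin_numE// path_modular_ge0.
Qed.

Lemma path_energyE f : W f -> path_energy f = \sum_i fine (sm (co f i)).
Proof.
by move=> Wf; rewrite /path_energy sum_fine// => i _; exact: coord_modular_fin.
Qed.

Lemma sobolev_spaceI f : (forall i, continuous (co f i)) ->
  (forall i, sm (co f i) < +oo)%E -> W f.
Proof.
move=> fc ff; apply/(sobolev_spaceP alpha T0 p1); split=> //.
by apply/lte_sum_pinfty => i _; exact: ff.
Qed.

Lemma coord_combination_continuous f g i (a : R) : W f -> W g ->
  continuous (fun t => co f i t + a * co g i t).
Proof.
move=> Wf Wg t; apply: cvgD; first exact: coord_continuous.
by apply: cvgM; [exact: cvg_cst|exact: coord_continuous].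
Qed.

Lemma sobolev_combination (f g : path) (a : R) : W f -> W g ->
  W (fun s => f s + a *: g s).
Proof.
move=> Wf Wg.
have E i : co (fun s => f s + a *: g s) i = fun t => co f i t + a * co g i t.
  by apply/funext => t; rewrite /path_coord !ffunE.
have cg i : continuous (fun t => a * co g i t).
  by move=> t; apply: cvgM; [exact: cvg_cst|exact: coord_continuous].
apply: sobolev_spaceI => i; rewrite E; first exact: coord_combination_continuous.
apply: (le_lt_trans (sobolev_modular_triangle _ _ p1 _ _)).
- exact: coord_continuous.
- exact: cg.
rewrite sobolev_modular_scale//; last exact: coord_continuous.
have sf h : W h -> (sm (co h i) < +oo)%E.
  by move=> Wh; rewrite -ge0_fin_numE ?sobolev_modular_ge0// coord_modular_fin.
apply: lte_add_pinfty; do ![apply: lte_mul_pinfty => //]; exact: sf.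
Qed.

Lemma sobolev_sub f g : W f -> W g -> W (f - g).
Proof.
move=> Wf Wg; have := sobolev_combination (-1) Wf Wg.
by congr (W _); apply/funext => s; rewrite scaleN1r.
Qed.

Lemma sobolev_mid f g : W f -> W g -> W (2^-1 *: f + (1 - 2^-1) *: g).
Proof.
move=> Wf Wg.
(* f - f is the zero path *)
have W0 := sobolev_sub Wf Wf.
have H1 := sobolev_combination 2^-1 W0 Wf.
have := sobolev_combination (1 - 2^-1) H1 Wg.
congr (W _); apply/funext => s.
by rewrite /= [(f - f) s]subrr add0r.
Qed.

Lemma sobolev_uniformly_convex : modular_uniformly_convex W path_energy.
Proof.
move=> e e0; have [C C0 HC] := powR_uniform_convexity p1 e0.
exists C; first exact: C0.
move=> f g Wf Wg.
have Wd := sobolev_sub Wf Wg; have Wm := sobolev_mid Wf Wg.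
rewrite (path_energyE Wd) (path_energyE Wm) (path_energyE Wf) (path_energyE Wg).
apply: sum_le_combination => i.
have := sobolev_modular_uniform_convexity T alpha (ltW e0) C0 HC
  (@coord_continuous f i Wf) (@coord_continuous g i Wg).
rewrite -coordB -coord_mid.
apply: fine_le_combination.
- exact: coord_modular_fin Wd.
- exact: coord_modular_fin Wm.
- exact: coord_modular_fin Wf.
- exact: coord_modular_fin Wg.
Qed.

Lemma sup_of_energy (eta : R) : 0 < eta -> exists2 dl : R, 0 < dl &
  forall f, W f -> path_energy f <= dl -> forall i s, `|f s i| <= eta.
Proof.
move=> eta0; have [dl dl0 H] := sobolev_modular_sup T0 p1 alphap eta0.
exists dl => // f Wf fd i s.
have -> : f s i = co f i (val s) by rewrite /path_coord clampK.
apply: H; [exact: coord_continuous| |exact: time_itv].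
apply: (le_trans (coord_modular_le _ _ _ _ i)).
by rewrite -(fineK (path_modular_fin Wf)) lee_fin.
Qed.

(** The Morrey estimate turns a Cauchy sequence into a uniformly Cauchy one.  Its
limit y is continuous, and Fatou's lemma, applied in m to x n - x m, bounds
Psi (x n - y). *)
Lemma sobolev_complete : modular_complete W path_energy.
Proof.
move=> x Wx Cx.
have unif (eta : R) : 0 < eta -> exists n0, forall n m, (n0 <= n)%N ->
    (n0 <= m)%N -> forall i s, `|x n s i - x m s i| <= eta.
  move=> eta0; have [dl dl0 H] := sup_of_energy eta0.
  have [n0 Hn0] := Cx dl dl0; exists n0 => n m nn mm i s.
  have := H _ (sobolev_sub (Wx n) (Wx m)) (Hn0 n m nn mm) i s.
  by rewrite !ffunE.
have xcvg i s : cvgn (fun n => x n s i : R).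
  apply/cauchy_cvgP/cauchy_exP => e e0.
  have e20 : 0 < e / 2 by rewrite divr_gt0.
  have [n0 Hn0] := unif _ e20; exists (x n0 s i); exists n0 => // m /= n0m.
  rewrite /ball /=; apply: le_lt_trans (Hn0 n0 m (leqnn _) n0m i s) _.
  by rewrite ltr_pdivrMr// ltr_pMr// ltr1n.
pose y : path := fun s => [ffun i => limn (fun n => x n s i : R)].
have xy i s : x n s i @[n --> \oo] --> (y s i : R).
  by rewrite ffunE; exact: xcvg.
have unify (eta : R) : 0 < eta -> exists n0, forall n, (n0 <= n)%N ->
    forall i s, `|x n s i - y s i| <= eta.
  move=> eta0; have [n0 Hn0] := unif eta eta0; exists n0 => n nn i s.
  have K : `|x n s i - x m s i| @[m --> \oo] --> `|x n s i - y s i|.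
    apply: cvg_norm; apply: cvgB; [exact: cvg_cst|exact: xy].
  rewrite -(cvg_lim _ K)//; apply: limr_le.
    by apply/cvg_ex; exists `|x n s i - y s i|.
  by exists n0 => // m /= mm; exact: Hn0.
have yc i : continuous (co y i).
  move=> t; apply/cvgrPdist_lt => e e0.
  have e30 : 0 < e / 3 by rewrite divr_gt0.
  have [n0 Hn0] := unify _ e30.
  have /cvgrPdist_lt /(_ _ e30) := @coord_continuous _ i (Wx n0) t.
  apply: filterS => u tu.
  have h1 := Hn0 n0 (leqnn _) i (clamp (ltW T0) t).
  have h2 := Hn0 n0 (leqnn _) i (clamp (ltW T0) u).
  rewrite /path_coord in tu *.
  move: h1 h2 tu; rewrite !(ler_norml, ltr_norml).
  move=> /andP[? ?] /andP[? ?] /andP[? ?]; apply/andP; split; lra.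
have close (e : R) : 0 < e -> exists n0, forall n, (n0 <= n)%N ->
    forall i, (sm (co (x n - y)%R i) <= e%:E + e%:E)%E.
  move=> e0; have [n0 Hn0] := Cx e e0; exists n0 => n nn i.
  apply: (sobolev_modular_fatou p1 (h_ := fun m => co (x n - x m) i)).
  - by move=> m; exact/coord_continuous/sobolev_sub.
  - move=> t tT; rewrite coordB; under eq_cvg do rewrite coordB.
    by apply: cvgB; [exact: cvg_cst|exact: xy].
  - exists n0 => m mm; apply: (le_trans (coord_modular_le _ _ _ _ i)).
    rewrite -(fineK (path_modular_fin (sobolev_sub (Wx n) (Wx m)))) lee_fin.
    exact: Hn0.
have Wd n0 : (forall i, sm (co (x n0 - y)%R i) < +oo)%E -> W (x n0 - y).
  move=> H; apply: sobolev_spaceI => // i; rewrite coordB => t.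
  by apply: cvgB; [exact: coord_continuous|exact: yc].
have Wy : W y.
  have [n0 Hn0] := close 1 ltr01.
  have Wn : W (x n0 - y).
    apply: Wd => i; apply: (le_lt_trans (Hn0 n0 (leqnn _) i)).
    by rewrite -EFinD ltry.
  have := sobolev_sub (Wx n0) Wn; congr (W _).
  by rewrite opprB addrC subrK.
exists y => // e e0.
have e'0 : 0 < e / (2 * (#|I|%:R + 1)) by rewrite divr_gt0// mulr_gt0// ltr_wpDl.
have [n0 Hn0] := close _ e'0; exists n0 => n nn.
have Wn := sobolev_sub (Wx n) Wy.
rewrite path_energyE//.
apply: (@le_trans _ _ (\sum_(i : I) (e / (#|I|%:R + 1)))).
  apply: ler_sum => i _; rewrite -lee_fin fineK ?coord_modular_fin//.
  apply: (le_trans (Hn0 n nn i)); rewrite -EFinD lee_fin.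
  rewrite le_eqVlt; apply/orP; left; apply/eqP.
  by field; rewrite ?gt_eqF// ltr_wpDl.
rewrite sumr_const -[leLHS]mulr_natl mulrCA ger_pMr//.
by rewrite ler_pdivrMr ?mul1r ?lerDl// ltr_wpDl.
Qed.

(** Convergence for the modular implies convergence in norm, and the lower
semi-continuity hypothesis is about the norm. *)
Lemma sublevel_closed (Phi : path -> \bar R) (a : R) :
  lower_semicontinuous_on W (sobolev_norm alpha p I) Phi ->
  modular_closed W path_energy [set f | W f /\ (Phi f <= a%:E)%E].
Proof.
move=> lsc x y Cx Wy xy; split=> //; rewrite leNgt; apply/negP => ay.
have [dl dl0 H] := lsc y a Wy ay.
have n1 : 0 < #|I|%:R `^ p + 1 :> R by rewrite ltr_wpDl// powR_ge0.
have d4 : 0 < dl / 4 by rewrite divr_gt0.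
have [|n0 Hn0] := xy ((dl / 4) `^ p / (#|I|%:R `^ p + 1)).
  by rewrite divr_gt0// powR_gt0.
have [Wx] := Cx n0; rewrite leNgt => /negP; apply; apply: H => //.
have := sobolev_norm_le_modular p1 (sobolev_sub Wx Wy) (Hn0 n0 (leqnn _)).
move=> /le_lt_trans; apply.
apply: (@le_lt_trans _ _ (2 * (dl / 4))); last by lra.
apply: ler_wpM2l => //.
have {2}-> : dl / 4 = ((dl / 4) `^ p) `^ p^-1.
  by rewrite -powRrM mulfV ?gt_eqF// powRr1// ltW.
apply: ge0_ler_powR; rewrite ?nnegrE ?powR_ge0 ?invr_ge0 ?(ltW p0)//.
  by rewrite !mulr_ge0 ?powR_ge0// invr_ge0 ltW.
rewrite mulrCA ger_pMr ?powR_gt0// ler_pdivrMr// mul1r lerDl.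
exact: ler01.
Qed.

Lemma energy_coercive (Phi : path -> \bar R) :
  coercive_on W (sobolev_norm alpha p I) Phi ->
  forall a : R, exists M : R, forall f, W f -> (Phi f <= a%:E)%E ->
    path_energy f <= M.
Proof.
move=> coer a; have [M HM] := coer a.
exists (#|I|%:R * (M `^ p + M `^ p)) => f Wf fa.
by apply: modular_le_sobolev_norm => //; exact: HM.
Qed.

Lemma sobolev_convex_minimizer (Phi : path -> \bar R) :
  (forall f, W f -> (-oo < Phi f)%E) -> (exists2 f, W f & (Phi f < +oo)%E) ->
  coercive_on W (sobolev_norm alpha p I) Phi -> convex_on W Phi ->
  lower_semicontinuous_on W (sobolev_norm alpha p I) Phi ->
  exists2 f, W f & forall g, W g -> (Phi f <= Phi g)%E.
Proof.
move=> Phiny Phiy coer conv lsc.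
apply: (convex_minimizer path_energy_ge0 sobolev_uniformly_convex
  sobolev_complete sobolev_mid Phiny Phiy conv (energy_coercive coer)).
by move=> a; exact: sublevel_closed.
Qed.

End PathSpace.

(** * Paths in the free nilpotent group *)

Section GroupPaths.
Context {R : realType} {N d : nat}.
Variables (T alpha p : R).
Hypotheses (T0 : 0 < T) (p1 : 1 < p).
Local Notation TN := (tensor R N d).
Local Notation mu := (@lebesgue_measure R).

Let p0 : 0 < p. Proof. exact: lt_trans ltr01 p1. Qed.

Variable Y : time T -> TN.
Hypothesis HY : sobolev_path alpha p free_group cc_dist Y.

Let nw : R := (#|{: word N d}| ^ 2)%:R.

Let Y1 t : Y t [bseq] = 1.
Proof. by have [Yg _ _] := HY; exact: free_group_nil. Qed.

Let coord_bound (t : time T) (w : word N d) : `|Y t w| <= \sum_u `|Y t u|.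
Proof. by rewrite (bigD1 w)//= lerDl; exact: sumr_ge0. Qed.

Lemma group_path_continuous (w : word N d) :
  continuous (fun t : R => Y (clamp (ltW T0) t) w : R).
Proof.
move=> t; apply/cvgrPdist_lt => e e0; have [_ Yc _] := HY.
set s := clamp (ltW T0) t; set A := \sum_u `|Y s u|.
have A0 : 0 <= A by exact: sumr_ge0.
have nA : 0 < nw * A + 1 by rewrite ltr_wpDl// mulr_ge0.
have [|dl dl0 H] := Yc s (Num.min 1 (e / (nw * A + 1))).
  by rewrite lt_min ltr01 divr_gt0.
exists dl => // u /= tu.
have {}H : (cc_dist (Y s) (Y (clamp (ltW T0) u)) <
    (Num.min 1 (e / (nw * A + 1)))%:E)%E.
  apply: H; apply: le_lt_trans tu; rewrite [leRHS]distrC.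
  exact: clamp_lipschitz.
have H1 : (cc_dist (Y s) (Y (clamp (ltW T0) u)) < 1)%E.
  by apply: (lt_le_trans H); rewrite lee_fin ge_min lexx.
have Hf : cc_dist (Y s) (Y (clamp (ltW T0) u)) \is a fin_num.
  by rewrite ge0_fin_numE ?cc_norm_ge0// (lt_trans H1)// ltry.
have := tensor_sub_cc (Y1 s) (coord_bound s) H1 w.
rewrite distrC => /le_lt_trans; apply.
move: H; rewrite -{1}(fineK Hf) lte_fin lt_min => /andP[_].
rewrite -/nw ltr_pdivlMr//; set c := fine _.
have c0 : 0 <= c by apply: fine_ge0; exact: cc_norm_ge0.
rewrite -/A; nra.
Qed.

Let ex_bound : exists2 A : R, 0 <= A & forall t w, `|Y t w| <= A.
Proof.
have /fin_all_exists[M HM] : forall w : word N d, exists M : R,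
    forall t, `|Y t w| <= M.
  move=> w.
  have [c _ cmax] : exists2 c, c \in `[0, T] & forall t, t \in `[0, T] ->
      `|Y (clamp (ltW T0) t) w| <= `|Y (clamp (ltW T0) c) w|.
    apply: (@EVT_max R (fun t => `|Y (clamp (ltW T0) t) w|)); first exact: ltW.
    apply: continuous_subspaceT => t.
    have K : Y (clamp (ltW T0) u) w @[u --> t] --> (Y (clamp (ltW T0) t) w : R).
      exact: group_path_continuous.
    exact: cvg_norm K.
  exists `|Y (clamp (ltW T0) c) w| => t; rewrite -{1}(clampK (ltW T0) t).
  by apply: cmax; rewrite in_itv/= time_itv.
exists (\sum_w `|M w|); first exact: sumr_ge0.
move=> t w; apply: (le_trans (HM w t)); apply: (le_trans (ler_norm _)).
by rewrite (bigD1 w)//= lerDl; exact: sumr_ge0.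
Qed.

(** The local estimate [tensor_sub_cc] holds at distance less than 1; at distance
at least 1 the bound on the path suffices. *)
Lemma group_path_lipschitz : exists2 c : R, 0 < c & forall s t w,
  ((c * `|Y t w - Y s w|)%:E <= cc_dist (Y s) (Y t))%E.
Proof.
have [A A0 HA] := ex_bound.
have K0 : 0 < nw * A + 2 * A + 1 by rewrite ltr_wpDl// addr_ge0// mulr_ge0.
exists (nw * A + 2 * A + 1)^-1; first by rewrite invr_gt0.
move=> s t w; have c0 : (0 <= cc_dist (Y s) (Y t))%E by exact: cc_norm_ge0.
have [lt1|ge1] := ltP (cc_dist (Y s) (Y t)) 1%E.
  have cf : cc_dist (Y s) (Y t) \is a fin_num.
    by rewrite ge0_fin_numE// (lt_trans lt1)// ltry.
  have H := tensor_sub_cc (Y1 s) (HA s) lt1 w; rewrite -/nw in H.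
  rewrite -(fineK cf) lee_fin mulrC ler_pdivrMr//.
  have : 0 <= fine (cc_dist (Y s) (Y t)) by exact: fine_ge0.
  move: H; set c := fine _ => H c0'; nra.
apply: le_trans ge1; rewrite lee_fin mulrC ler_pdivrMr// mul1r.
apply: (le_trans (ler_normB _ _)).
have : 0 <= nw * A by rewrite mulr_ge0.
have := HA t w; have := HA s w; lra.
Qed.

(** Each coordinate increment is dominated by the Carnot-Caratheodory distance, so
its weighted p-th power is dominated by the integrand of the energy. *)
Lemma group_path_sobolev :
  sobolev_space alpha p (pos_word N d) (drop_level0 \o Y).
Proof.
have E i : path_coord T0 (drop_level0 \o Y) i =
    fun t => Y (clamp (ltW T0) t) (val i) :> R.
  by apply/funext => t; rewrite /path_coord /= ffunE.
have fc i : continuous (path_coord T0 (drop_level0 \o Y) i).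
  by rewrite E; exact: group_path_continuous.
apply: sobolev_spaceI => // i; apply: lte_add_pinfty.
  exact: modular_itv_fin.
have [c c0 Hc] := group_path_lipschitz; have [_ _ Efin] := HY.
have cp : 0 < `|c| `^ p by rewrite powR_gt0// normr_gt0 gt_eqF.
set B := modular _ _ _ _ _.
suff : ((`|c| `^ p)%:E * B < +oo)%E.
  rewrite !ltey; apply: contra => /eqP ->.
  by rewrite mulry gtr0_sg// mul1e.
rewrite /B -modular_scale//; last 4 first.
- exact: measurable_square.
- by move=> z; exact: sobolev_weight_ge0.
- exact: measurable_sobolev_weight.
- apply: measurable_increment; exact: continuous_measurable_fun.
apply: le_lt_trans Efin; rewrite /sobolev_energy /time_integral2 /modular.
apply: ge0_le_integral_nomeas => -[s t] [sT' tT'].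
  by rewrite lee_fin mulr_ge0// ?powR_ge0// sobolev_weight_ge0.
have sT : 0 <= s <= T by move: sT'; rewrite /= in_itv.
have tT : 0 <= t <= T by move: tT'; rewrite /= in_itv.
rewrite [(s, t).1]/= [(s, t).2]/=.
rewrite (valL_clamp (ltW T0))// (valL_clamp (ltW T0))// !val_clamp//.
rewrite EFinM muleC /sobolev_weight; apply: lee_wpmul2r.
  by rewrite lee_fin invr_ge0 powR_ge0.
rewrite -poweR_EFin; apply: gt0_ler_poweR; first exact: ltW.
- by rewrite in_itv/= leey andbT lee_fin.
- by rewrite in_itv/= leey andbT cc_norm_ge0.
rewrite normrM gtr0_norm//; apply: le_trans (Hc _ _ (val i)).
by rewrite /increment !E distrC.
Qed.

End GroupPaths.

Lemma drop_level0_path_inj (R : realType) (N d : nat) (T : R)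
    (Y Z : time T -> tensor R N d) :
  (forall t, Y t [bseq] = 1) -> (forall t, Z t [bseq] = 1) ->
  drop_level0 \o Y = drop_level0 \o Z -> Y = Z.
Proof.
move=> Y1 Z1 YZ; apply/funext => t; apply/ffunP => w.
have [w0|w0] := posnP (size w).
  have -> : w = [bseq] by apply: val_inj; apply/size0nil.
  by rewrite Y1 Z1.
have := congr1 (fun f : time T -> pos_tensor R N d => f t (Sub w w0)) YZ.
by rewrite /= !ffunE.
Qed.

(** * Existence and uniqueness of the minimizer *)

Theorem theorem3p4 (R : realType) (T : R) (d : nat) (alpha p : R)
  (hT : 0 < T) (halpha : 0 < alpha < 1) (hp : 1 < p) (halphap : p^-1 < alpha)
  (N : nat) (hN : N = Num.truncn alpha^-1)
  (K : set (tensor R N d))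
  (hK : closed_subgroup (texp @` lie_layer N) K)
  (X : time T -> set (tensor R N d))
  (hX : sobolev_path alpha p (coset_space K) quotient_dist X)
  (F : (time T -> tensor R N d) -> \bar R)
  (hF : forall Y, admissible alpha p K X Y -> (-oo < F Y)%E)
  (hF_proper : exists2 Y, admissible alpha p K X Y & F Y \is a fin_num)
  (Fbar : (time T -> pos_tensor R N d) -> \bar R)
  (hext : forall Y, admissible alpha p K X Y -> Fbar (drop_level0 \o Y) = F Y)
  (hout : forall f, sobolev_space alpha p (pos_word N d) f ->
     ~ ([set drop_level0 \o Y | Y in admissible alpha p K X] f) ->
     Fbar f = +oo%E)
  (hcoercive : coercive_on (sobolev_space alpha p (pos_word N d))
     (sobolev_norm alpha p (pos_word N d)) Fbar)
  (hconvex : convex_on (sobolev_space alpha p (pos_word N d)) Fbar)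
  (hlsc : lower_semicontinuous_on (sobolev_space alpha p (pos_word N d))
     (sobolev_norm alpha p (pos_word N d)) Fbar) :
  (exists Y, is_minimizer (admissible alpha p K X) F Y) /\
  (strictly_convex_on
     [set drop_level0 \o Y | Y in admissible alpha p K X] Fbar ->
   exists! Y, is_minimizer (admissible alpha p K X) F Y).
Proof.
set W := sobolev_space alpha p (pos_word N d) in hout hcoercive hconvex hlsc.
set A := admissible alpha p K X in hF hF_proper hext hout *.
set DA := [set drop_level0 \o Y | Y in A] in hout *.
have AW Y : A Y -> W (drop_level0 \o Y).
  by move=> [HY _]; exact: group_path_sobolev.
have [Y0 AY0 FY0] := hF_proper.
have Fbar_ny f : W f -> (-oo < Fbar f)%E.
  move=> Wf; have [[Y AY <-]|nDA] := pselect (DA f); first by rewrite hext// hF.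
  by rewrite hout.
have F0y : (F Y0 < +oo)%E by rewrite ltey_eq FY0.
have [f Wf fmin] : exists2 f, W f & forall g, W g -> (Fbar f <= Fbar g)%E.
  apply: sobolev_convex_minimizer => //; exists (drop_level0 \o Y0).
    exact: AW.
  by rewrite hext.
have Ff : (Fbar f < +oo)%E.
  by apply: le_lt_trans F0y; rewrite -hext//; exact/fmin/AW.
have [Y AY Yf] : DA f.
  by apply: contrapT => /(hout f Wf) e; rewrite e ltxx in Ff.
have Ymin : is_minimizer A F Y.
  by split=> // Z AZ; rewrite -!hext// Yf; exact/fmin/AW.
split; first by exists Y.
move=> strict; exists Y; split => // Z [AZ Zmin].
have FZ : F Z = F Y by apply/le_anti; rewrite Zmin//= Ymin.2.
apply: drop_level0_path_inj.
- by move=> t; case: AY => -[Yg _ _] _; exact: free_group_nil.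
- by move=> t; case: AZ => -[Zg _ _] _; exact: free_group_nil.
apply: contrapT => YZ.
(* two distinct minimizers would be beaten by their midpoint *)
have half : 0 < (2^-1 : R) < 1 by rewrite invr_gt0 ltr0n invf_lt1 ?ltr1n.
have FYy : (F Y < +oo)%E by rewrite -hext// Yf.
have := strict (drop_level0 \o Y) (drop_level0 \o Z) 2^-1.
rewrite !hext// FZ => /(_ _ _ FYy FYy YZ half).
move=> /(_ (ex_intro2 _ _ Y AY erefl) (ex_intro2 _ _ Z AZ erefl)).
have FYfin : F Y \is a fin_num by rewrite fin_numE gt_eqF ?hF//= lt_eqF.
have -> : ((2^-1)%:E * F Y + (1 - 2^-1)%:E * F Y = F Y)%E.
  by rewrite -(fineK FYfin) -!EFinM -EFinD -mulrDl addrC subrK mul1r.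
apply/negP; rewrite -leNgt -[leLHS]hext// Yf; apply: fmin.
apply: (sobolev_mid hT hp); [exact: Wf|exact: AW].
Qed.
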